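(* Let $W$ be a real random variable with $W\ge 0$, $\mathbb{E}W=1$, $\mathbb{E}[W\log_2^+W]<\infty$ and $\mathbb{E}[W\log_2 W]<1$. Let $\mu$ be the canonical scalar dyadic Mandelbrot cascade on $[0,1]$ generated by $W$. Then, almost surely on the event $\{\mu([0,1])>0\}$, $$\widehat{\mu}(\xi)\longrightarrow 0\qquad(|\xi|\to\infty,\ \xi\in\mathbb{R}).$$
   Context: Conventions: $\log_2^+x=\max\{\log_2 x,0\}$ and $0\log_2 0=0$. Dyadic tree. For a word $u=(u_1,\dots,u_n)\in\{0,1\}^n$ write $|u|=n$, $u|k=(u_1,\dots,u_k)$, and $a_u=\sum_{j=1}^n u_j2^{-j}$. Let $I_\varnothing=[0,1]$ and, for $n\ge1$, $I_u=[a_u,a_u+2^{-n})$ unless $u=(1,\dots,1)$, in which case $I_u=[a_u,1]$. Cascade. Attach i.i.d. copies $W_u$ of $W$ to all nonempty finite words $u$. Set $A_\varnothing=1$ and $A_u=2^{-n}\prod_{k=1}^nW_{u|k}$ for $|u|=n$, and let $\mu_n$ be the measure on $[0,1]$ with density $\sum_{|u|=n}2^nA_u\mathbf 1_{I_u}(t)$ with respect to Lebesgue measure. Under the stated assumptions on $W$, almost surely $\mu_n$ converges weakly to a finite Borel measure $\mu$ on $[0,1]$; this $\mu$ is the canonical scalar dyadic Mandelbrot cascade generated by $W$. Fourier transform: for a finite Borel measure $\nu$ on $\mathbb{R}^d$, $\widehat\nu(\xi)=\int_{\mathbb{R}^d}e^{-2\pi i\xi\cdot x}\,d\nu(x)$.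 *)

(* Defs.v *)
From HB Require Import structures.
From mathcomp Require Import all_boot all_order all_algebra.
From mathcomp Require Import complex.
From mathcomp Require Import all_classical all_reals all_analysis.
Set Implicit Arguments.
Unset Strict Implicit.
Unset Printing Implicit Defensive.
Import Order.TTheory GRing.Theory Num.Theory.
Import numFieldNormedType.Exports.
Local Open Scope classical_set_scope.
Local Open Scope ring_scope.

(* As [ln] vanishes on [`]-oo, 0]], [x * log2 x] is [0] at [x = 0]. *)
Definition log2 {R : realType} (x : R) : R := ln x / ln 2.

Definition log2plus {R : realType} (x : R) : R := Num.max (log2 x) 0.

Section dyadic.
Variable R : realType.

Definition dyadic_point (u : seq bool) : R :=
  \sum_(j < size u) (nth false u j)%:R * 2 ^- j.+1.

(* [all id u] says that [u] is [(1, ..., 1)]; it also covers the empty word,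
   whose interval is [`[0, 1]]. *)
Definition dyadic_interval (u : seq bool) : set R :=
  if all id u then `[dyadic_point u, 1]%classic
  else `[dyadic_point u, dyadic_point u + 2 ^- size u[%classic.

End dyadic.

Section iid.
Context {d : measure_display} {T : measurableType d} {R : realType}.
Variable P : probability T R.

Definition mutually_independent (I : eqType) (D : set I)
    (X : I -> {RV P >-> R}) : Prop :=
  forall (J : seq I) (B : I -> set R), uniq J ->
    (forall i, i \in J -> D i) -> (forall i, measurable (B i)) ->
    P (\bigcap_(i in [set` J]) (X i @^-1` B i)) =
    (\prod_(i <- J) P (X i @^-1` B i))%E.

Definition iid_copies {d0 : measure_display} {T0 : measurableType d0}
    {P0 : probability T0 R} (W : {RV P0 >-> R})
    (I : eqType) (D : set I) (X : I -> {RV P >-> R}) : Prop :=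
  mutually_independent D X /\
  forall i, D i -> forall B : set R, measurable B ->
    distribution P (X i) B = distribution P0 W B.

End iid.

Definition nonempty_words : set (seq bool) := [set u | u != [::]].

Section cascade.
Variable R : realType.

(* [w u] is the weight [W_u] at the word [u]; [w [::]] is never used. *)
Definition cascade_weight (w : seq bool -> R) (u : seq bool) : R :=
  2 ^- size u * \prod_(1 <= k < (size u).+1) w (take k u).

Definition cascade_density (w : seq bool -> R) (n : nat) (t : R) : R :=
  \sum_(u : n.-tuple bool)
    2 ^+ n * cascade_weight w u * \1_(dyadic_interval u) t.

(* The weights are nonnegative only almost surely, hence [cascade_approx w n]
   is a bare set function; it is a measure whenever the density is
   nonnegative. *)
Definition cascade_approx (w : seq bool -> R) (n : nat)
    : set (measurableTypeR R) -> \bar R :=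
  fun B => (\int[lebesgue_measure]_(t in B) (cascade_density w n t)%:E)%E.

Definition weak_cvg (nu_ : nat -> set (measurableTypeR R) -> \bar R)
    (nu : set (measurableTypeR R) -> \bar R) : Prop :=
  forall f : R -> R, continuous f -> [bounded f x | x in [set: R]] ->
    (\int[nu_ n]_x (f x)%:E)%E @[n --> \oo] --> (\int[nu]_x (f x)%:E)%E.

(* Measures on [`[0, 1]] are seen as measures on [R]: each [cascade_approx w n]
   is carried by the compact set [`[0, 1]], hence so is its weak limit. *)
Definition is_mandelbrot_cascade {d : measure_display} {T : measurableType d}
    (P : probability T R) (X : seq bool -> {RV P >-> R})
    (mu : T -> {finite_measure set (measurableTypeR R) -> \bar R}) : Prop :=
  {ae P, forall t : T,
    weak_cvg (cascade_approx (fun u => X u t)) (mu t)}.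

End cascade.

(* [exp (- 2 pi i xi x)] is integrated componentwise. *)
Definition fourier_transform {R : realType}
    (nu : {finite_measure set (measurableTypeR R) -> \bar R}) (xi : R)
    : R[i]^o :=
  Complex (Rintegral nu setT (fun x => cos (2 * pi * xi * x)))
          (- Rintegral nu setT (fun x => sin (2 * pi * xi * x))).

(* Main.v *)
Require Import Defs.
From HB Require Import structures.
From mathcomp Require Import all_boot all_order all_algebra.
From mathcomp Require Import complex.
From mathcomp Require Import all_classical all_reals all_analysis.
From mathcomp Require Import measurable_realfun ring lra zify.
Set Implicit Arguments.
Unset Strict Implicit.
Unset Printing Implicit Defensive.
Import Order.TTheory GRing.Theory Num.Theory.
Import numFieldNormedType.Exports.
Local Open Scope classical_set_scope.
Local Open Scope ring_scope.

(** Under the drift hypothesis there are [eta, del > 0] such that the size-biased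
    mean of [ln (max W eta)] is at most [ln 2 - 2 del]. Fix an offset [K] and
    kill a word [u] as soon as, at some level [k <= |u|], either the weight is
    larger than [exp (del (k + K) / 2)] or the centered walk of clipped
    logarithms exceeds [del (k + K)]. The weight of a surviving word of length
    [n] is [O (exp (- del n))], and by a Kolmogorov-type estimate under the
    size-biased law the expected killed mass is at most the tail from [K] of a
    convergent series.

    The increment of the Fourier integral of the pruned cascade from level [n]
    to level [n + 1] is a sum of centered terms, independent given the first
    [n] levels and exponentially small, plus a loss due to killing. A Chernoff
    bound, applied at the [q 4^n] frequencies [j / q <= 4^n], makes these sums
    summable uniformly over the grid, almost surely. For a frequency of size
    about [4^N] the level [N] pruned cascade has Fourier transform [O (2^-N)],
    each dyadic interval of length [2^-N] being long compared with a period.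
    Hence the pruned Fourier integrals at high frequency stay small at all later
    levels; the unpruned ones differ from them by the killed mass, which is small
    along a subsequence by Fatou's lemma. Weak convergence passes this to [mu],
    whose transform is Lipschitz, so the grid suffices. The real phases
    [cos (2 pi xi x - th)], with [th] a multiple of [pi / 2], give one-sided
    bounds that together control the modulus. *)

(** * Integration against a fresh coordinate *)

(** Only [W log W] is integrable: the weight need not have a second moment, nor its logarithm a
    variance under the size-biased law, so exponential moments are out of reach for the raw cascade.
    Truncating at thresholds linear in the level repairs both defects. Variances divided by [k ^ 2]
    become summable under a first moment of the logarithm, as in the strong law of large numbers,
    and a truncated weight has a second moment of the order of its threshold, which the exponential
    decay of surviving weights outweighs.

    The union over frequencies is affordable because the grid grows only exponentially in [n]: its
    logarithm is linear in [n], while the Chernoff parameter is exponential in [n], so their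
    quotient is summable.

    Survival depends on the whole branch, so a pruned increment is not centered. Truncation by the
    weight alone keeps a constant mean and independence; what the walk condition removes is charged
    separately as a loss. This yields upper bounds only, hence the use of several phases. *)

Section independent_integration.
Local Open Scope ereal_scope.
Context {d : measure_display} {T : measurableType d} {R : realType}.
Variables (P : probability T R) (La : probability (measurableTypeR R) R).
Variables (G : set (set T)) (Y : {RV P >-> R}).
Hypotheses (Gm : G `<=` measurable) (GI : setI_closed G) (GT : G setT).
Hypothesis GY : forall A (B : set R), G A -> measurable B ->
  P (A `&` Y @^-1` B) = P A * La B.

Let sGm (A : set T) : <<s G >> A -> measurable A.
Proof. by move: A; apply: smallest_sub => //; exact: sigma_algebra_measurable. Qed.

Let mY : measurable_fun setT Y. Proof. exact: measurable_funP. Qed.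

(** For fixed [B] both sides are finite measures in [A] that agree on the pi-system [G]. *)
Let sGY (A : set T) (B : set R) : <<s G >> A -> measurable B ->
  P (A `&` Y @^-1` B) = P A * La B.
Proof.
move=> sGA mB.
have mYB : measurable (Y @^-1` B) by rewrite -[_ @^-1` _]setTI; exact: mY.
have LaB : (0 <= fine (La B))%R by rewrite fine_ge0.
pose m1 : {measure set T -> \bar R} := mrestr P mYB.
pose m2 : {measure set T -> \bar R} := mscale (NngNum LaB) P.
have E2 C : m2 C = P C * La B.
  by rewrite /m2 /= /mscale /= fineK ?fin_num_measure// muleC.
rewrite -E2 -[LHS]/(m1 A).
apply: (@g_sigma_algebra_measure_unique _ _ _ G Gm (fun=> setT)) => //.
- by rewrite bigcup_const//; exists 0%N.
- by move=> C GC; rewrite E2 -GY.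
- by move=> _; rewrite ltey_eq fin_num_measure.
Qed.

Let TG := g_sigma_algebraType G.

Let mid : measurable_fun setT (id : T -> TG).
Proof. by move=> _ B mB; rewrite setTI; exact: sGm. Qed.

Let TGR : measurableType _ := (g_sigma_algebraType G * measurableTypeR R)%type.

Let joint (t : T) : TGR := (t, Y t).

Let mjoint : measurable_fun setT joint.
Proof. by apply/measurable_fun_pairP; split. Qed.


Let idm : {mfun T >-> TG} := HB.pack (id : T -> TG) (isMeasurableFun.Build _ _ _ _ _ mid).
Let jointm : {mfun T >-> TGR} :=
  HB.pack joint (isMeasurableFun.Build _ _ _ _ _ mjoint).

(* The joint law of the [<<s G >>]-measurable part and of [Y] is a product
   measure, so that Tonelli applies. *)
Lemma integral_independent (f : g_sigma_algebraType G * measurableTypeR R -> \bar R) :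
  measurable_fun [set: g_sigma_algebraType G * measurableTypeR R] f -> (forall z, 0 <= f z) ->
  \int[P]_t f (t, Y t) = \int[P]_t \int[La]_y f (t, y).
Proof.
move=> mf f0.
have jointE A : measurable A ->
    (distribution P idm \x La) A = distribution P jointm A.
  move=> mA; apply: (@product_measure_unique _ _ _ _ _ (distribution P idm) La
    (distribution P jointm)) => // B C mB mC; rewrite -[RHS]sGY//.
have mF := measurable_fun_fubini_tonelli_F (m2 := La) f mf f0.
transitivity (\int[distribution P jointm]_z f z).
  by rewrite ge0_integral_pushforward.
transitivity (\int[distribution P idm \x La]_z f z).
  apply: eq_measure_integral => A mA _; exact/esym/jointE.
rewrite fubini_tonelli1// ge0_integral_pushforward//.
by move=> t _; apply: integral_ge0.
Qed.

End independent_integration.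

Section family_sigma_algebra.
Context {d : measure_display} {T : measurableType d} {R : realType}.
Variables (P : probability T R) (La : probability (measurableTypeR R) R).
Context {I : eqType}.
Variables (D : set I) (X : I -> {RV P >-> R}).

(** A pi-system generating the sigma-algebra of the coordinates in [J]. The lists are duplicate-free
    so that [mutually_independent] applies to them. *)
Definition cylinders (J : set I) : set (set T) :=
  [set A | exists (s : seq I) (B : I -> set R),
    [/\ uniq s, forall i, i \in s -> J i, forall i, measurable (B i) &
        A = \bigcap_(i in [set` s]) (X i @^-1` B i)]].

Let mX i (B : set R) : measurable B -> measurable (X i @^-1` B).
Proof. by move=> mB; rewrite -[_ @^-1` _]setTI; exact: measurable_funP. Qed.

Lemma cylinders_measurable J : cylinders J `<=` measurable.
Proof.
move=> _ [s [B [us sJ mB ->]]].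
by apply: fin_bigcap_measurable => [|i _]; [exact: finite_seq|exact: mX].
Qed.

Lemma cylinders_setT J : cylinders J setT.
Proof.
exists [::], (fun=> setT); split => //.
by apply/esym; rewrite -subTset => t _ i.
Qed.

Lemma cylinders_setI J : setI_closed (cylinders J).
Proof.
move=> _ _ [s1 [B1 [us1 s1J mB1 ->]]] [s2 [B2 [us2 s2J mB2 ->]]].
exists (undup (s1 ++ s2)),
  (fun i => (if i \in s1 then B1 i else setT) `&`
            (if i \in s2 then B2 i else setT)); split.
- exact: undup_uniq.
- by move=> i; rewrite mem_undup mem_cat => /orP[/s1J|/s2J].
- by move=> i; apply: measurableI; case: ifP.
- apply/seteqP; split=> [t [h1 h2] i /= _|t h].
    by split; case: ifPn => // ?; [exact: h1|exact: h2].
  by split=> i /= si; have := h i; rewrite /= mem_undup mem_cat si ?orbT => /(_ isT)[].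
Qed.

Lemma measurable_coordinate (J : set I) i : J i ->
  measurable_fun [set: g_sigma_algebraType (cylinders J)] (X i : _ -> R).
Proof.
move=> Ji _ B mB; rewrite setTI; apply: sub_sigma_algebra.
exists [:: i], (fun=> B); split => //.
  by move=> j; rewrite inE => /eqP ->.
apply/seteqP; split=> [t ? j /=|t /(_ i)]; first by rewrite inE => /eqP ->.
by apply; rewrite /= inE.
Qed.

Lemma measurable_from_cylinders {d' : measure_display} {U : measurableType d'}
    (J : set I) (f : T -> U) :
  measurable_fun [set: g_sigma_algebraType (cylinders J)] f ->
  measurable_fun [set: T] f.
Proof.
move=> mf _ B mB; rewrite setTI.
have := mf measurableT B mB; rewrite setTI.
apply: smallest_sub; last exact: cylinders_measurable.
exact: sigma_algebra_measurable.
Qed.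

Hypothesis X_indep : mutually_independent D X.
Hypothesis X_law : forall i, D i -> forall B : set R, measurable B ->
  P (X i @^-1` B) = La B.

(** A coordinate outside [J] is integrated out under its own law while everything that depends on
    [J] is frozen. This replaces conditional expectation throughout. *)
Lemma integral_fresh (J : set I) i
    (f : g_sigma_algebraType (cylinders J) * measurableTypeR R -> \bar R) :
  J `<=` D -> D i -> ~ J i ->
  measurable_fun [set: g_sigma_algebraType (cylinders J) * measurableTypeR R] f ->
  (forall z, (0 <= f z)%E) ->
  (\int[P]_t f (t, X i t) = \int[P]_t \int[La]_y f (t, y))%E.
Proof.
move=> JD Di Ji mf f0.
apply: integral_independent => //.
- exact: cylinders_measurable.
- exact: cylinders_setI.
- exact: cylinders_setT.
move=> _ B [s [C [us sJ mC ->]]] mB.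
have sNi : i \notin s by apply/negP => /sJ.
have sD j : j \in s -> D j by move=> /sJ /JD.
(* Placing [B] at the new index makes the intersection a single cylinder over [i :: s], to which
   independence applies. *)
pose C' j := if j == i then B else C j.
have mC' j : measurable (C' j) by rewrite /C'; case: ifP.
have C's j : j \in s -> C' j = C j.
  by move=> js; rewrite /C' ifN//; apply: contraNneq sNi => <-.
have E1 : \bigcap_(j in [set` s]) X j @^-1` C j =
          \bigcap_(j in [set` s]) X j @^-1` C' j.
  by apply: eq_bigcapr => j /= /C's ->.
have E2 : \bigcap_(j in [set` s]) X j @^-1` C j `&` X i @^-1` B =
          \bigcap_(j in [set` i :: s]) X j @^-1` C' j.
  rewrite E1 (_ : [set` i :: s] = i |` [set` s]); last first.
    by apply/seteqP; split=> j /=; rewrite inE => /predU1P.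
  by rewrite bigcap_setU1 setIC; congr (_ `&` _); rewrite /C' eqxx.
rewrite E2 E1 X_indep//=; last 2 first.
- by rewrite sNi.
- by move=> j; rewrite inE => /predU1P[->|/sD].
by rewrite big_cons X_indep// muleC; congr (_ * _)%E; rewrite /C' eqxx X_law.
Qed.

End family_sigma_algebra.

(** * Words, walks and pruning *)

(** Letters are appended at the end, so that a sum over level [n + 1] is a sum over parents of their
    two children. [sum_tuple_words] makes the link with the tuples of [cascade_density]. *)
Fixpoint words (n : nat) : seq (seq bool) :=
  if n is n'.+1 then
    flatten [seq [:: rcons u false; rcons u true] | u <- words n']
  else [:: [::]].

Lemma big_wordsS (V : Type) (idx : V) (op : Monoid.law idx) n
    (F : seq bool -> V) :
  \big[op/idx]_(v <- words n.+1) F v =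
  \big[op/idx]_(u <- words n) op (F (rcons u false)) (F (rcons u true)).
Proof.
rewrite big_flatten big_map; apply: eq_bigr => u _.
by rewrite !big_cons big_nil Monoid.mulm1.
Qed.

Lemma mem_words n u : (u \in words n) = (size u == n).
Proof.
elim: n u => [|n IH] u /=; first by rewrite inE size_eq0.
apply/flatten_mapP/idP => [[v]|].
  by rewrite IH !inE => /eqP <- /orP[] /eqP ->; rewrite size_rcons.
case/lastP: u => [//|u b]; rewrite size_rcons eqSS => su.
by exists u; rewrite ?IH// !inE; case: b; rewrite eqxx ?orbT.
Qed.

Lemma words_uniq n : uniq (words n).
Proof.
elim: n => //= n; elim: (words n) => //= u s IH /andP[us /IH {}IH].
have rNs b : rcons u b \notin
    flatten [seq [:: rcons v false; rcons v true] | v <- s].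
  apply/flatten_mapP => -[v vs].
  by rewrite !inE !eqseq_rcons => /orP[]/andP[/eqP uv]; rewrite uv vs in us.
by rewrite inE eqseq_rcons eqxx/= !rNs.
Qed.

Lemma size_words n : size (words n) = (2 ^ n)%N.
Proof.
elim: n => //= n IH; rewrite size_flatten /shape -map_comp expnS -IH.
by elim: (words n) => //= u s ->; rewrite mulnS.
Qed.

Lemma sum_tuple_words (V : nmodType) n (F : seq bool -> V) :
  \sum_(u : n.-tuple bool) F u = \sum_(u <- words n) F u.
Proof.
rewrite -(big_map (@tval n bool) xpredT F); apply: perm_big.
apply: uniq_perm; last 1 first.
- move=> u; rewrite mem_words; apply/mapP/idP => [[v _ ->]|su].
    by rewrite size_tuple.
  by exists (Tuple su); rewrite ?mem_index_enum.
- by rewrite map_inj_uniq ?index_enum_uniq//; exact: val_inj.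
- exact: words_uniq.
Qed.

(** Weights, walks and survival are all iterated operations over prefixes; this recursion opens each
    of them to induction on the last letter. *)
Lemma big_prefix_rcons (V : Type) (idx : V) (op : Monoid.law idx)
    (F : nat -> seq bool -> V) u b :
  \big[op/idx]_(1 <= k < (size (rcons u b)).+1) F k (take k (rcons u b)) =
  op (\big[op/idx]_(1 <= k < (size u).+1) F k (take k u))
     (F (size u).+1 (rcons u b)).
Proof.
rewrite size_rcons big_nat_recr//= -[X in take X](size_rcons u b) take_size.
congr (op _ _); apply: eq_big_nat => k /andP[_]; rewrite ltnS => ku.
by rewrite -cats1 takel_cat.
Qed.

Lemma cascade_weight_rcons (R : realType) (w : seq bool -> R) u b :
  cascade_weight w (rcons u b) = cascade_weight w u / 2 * w (rcons u b).
Proof.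
rewrite /cascade_weight (big_prefix_rcons _ (fun _ v => w v)) size_rcons.
by rewrite /= exprS invfM; ring.
Qed.

Section pruning.
Context {R : realType}.
Variables (eta del : R) (K : nat) (m : nat -> R).

(** The floor [eta] copes with weights near [0], the cap gives a finite second moment. The cap is
    the logarithm of the threshold in [small_weight], so it never acts on a weight that passes that
    test. *)
Definition clip_log k (y : R) : R :=
  Num.min (ln (Num.max y eta)) (del / 2 * k%:R).

(** The interval starts at [0] so that a negative weight is killed too: nonnegativity holds only
    almost surely. *)
Definition small_weight k (y : R) : R :=
  \1_(`[0, expR (del / 2 * k%:R)]%classic : set R) y.

Definition low k (y : R) : R := \1_(`]-oo, del * k%:R]%classic : set R) y.

Definition walk (w : seq bool -> R) (u : seq bool) : R :=
  \sum_(1 <= k < (size u).+1) (clip_log (k + K) (w (take k u)) - m (k + K)%N).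

(* [m k] stands for the size-biased mean of [clip_log k], and [K] shifts every
   threshold so that little mass is killed when [K] is large. *)
Definition alive (w : seq bool -> R) (u : seq bool) : R :=
  \prod_(1 <= k < (size u).+1)
    (small_weight (k + K) (w (take k u)) * low (k + K) (walk w (take k u))).

Lemma walk_rcons w u b : walk w (rcons u b) =
  walk w u + (clip_log ((size u).+1 + K) (w (rcons u b)) - m ((size u).+1 + K)%N).
Proof. by rewrite /walk (big_prefix_rcons _ (fun k v => clip_log (k + K) (w v) - m (k + K)%N)). Qed.

Lemma alive_rcons w u b : alive w (rcons u b) =
  alive w u * (small_weight ((size u).+1 + K) (w (rcons u b)) *
               low ((size u).+1 + K) (walk w (rcons u b))).
Proof.
by rewrite /alive
  (big_prefix_rcons _ (fun k v => small_weight (k + K) (w v) * low (k + K) (walk w v))).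
Qed.

Lemma alive01 w u : alive w u = 0 \/ alive w u = 1.
Proof.
elim/last_ind: u => [|u b IH].
  by right; rewrite /alive /= big_nil.
rewrite alive_rcons /small_weight /low !indicE.
by case: IH => ->; case: (_ \in _); case: (_ \in _);
  rewrite ?mulr0 ?mul0r ?mulr1 ?mul1r; (by left) || (by right).
Qed.

Lemma alive_ge0 w u : 0 <= alive w u.
Proof. by case: (alive01 w u) => ->. Qed.

Lemma alive_le1 w u : alive w u <= 1.
Proof. by case: (alive01 w u) => ->. Qed.

Hypotheses (eta0 : 0 < eta) (eta1 : eta <= 1) (del0 : 0 < del).
Hypothesis mE : forall k, m k <= ln 2 - 2 * del.

(** A surviving weight [y] is at most [expR (clip_log n y)]. As [m n <= ln 2 - 2 * del], the factor
    [y / 2] is at most the exponential of the centered step minus [2 * del]. *)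
Lemma alive_weight w u : alive w u != 0 ->
  0 <= cascade_weight w u <= expR (walk w u - 2 * del * (size u)%:R).
Proof.
elim/last_ind: u => [|u b IH].
  by rewrite /cascade_weight /walk /= !big_nil mulr0 subr0 expR0 invr1 mulr1 ler01 lexx.
rewrite alive_rcons => /[dup] h.
rewrite !mulf_eq0 !negb_or => /and3P[/IH/andP[A0 A1] + _].
rewrite /small_weight indicE pnatr_eq0 eqb0 negbK inE/= in_itv/= => /andP[w0 w1].
rewrite cascade_weight_rcons mulr_ge0 ?divr_ge0//=.
set n := ((size u).+1 + K)%N in w1 *; set y := w _ in w0 w1 *.
have ye : 0 < Num.max y eta by rewrite lt_max eta0 orbT.
(* The cap is nonnegative, so its exponential is at least [1 >= eta]; with [w1] it does not act. *)
have zE : clip_log n y = ln (Num.max y eta).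
  rewrite /clip_log; apply/min_idPl; rewrite -ler_expR lnK ?posrE//.
  by rewrite ge_max w1 (le_trans eta1)// -[leLHS]expR0 ler_expR !mulr_ge0// ltW.
have yz : y <= expR (clip_log n y) by rewrite zE lnK ?posrE// le_max lexx.
have -> : walk w (rcons u b) - 2 * del * (size (rcons u b))%:R =
    (walk w u - 2 * del * (size u)%:R) + (clip_log n y - m n - 2 * del).
  by rewrite walk_rcons size_rcons -/n -/y -[X in X%:R]addn1 natrD; ring.
rewrite expRD -mulrA ler_pM//; first by rewrite mulr_ge0.
rewrite mulrC ler_pdivrMr//.
apply: (le_trans yz); rewrite -[X in _ * X](@lnK R) ?posrE// -expRD ler_expR.
by have := mE n; lra.
Qed.

(** [low] allows the walk to reach [del * (n + K)], which spends half of the decay [2 * del * n] in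
    [alive_weight]. *)
Definition alive_bound n : R := expR (del * K%:R - del * n%:R).

Lemma alive_weight_bound w u :
  0 <= cascade_weight w u * alive w u <= alive_bound (size u).
Proof.
have [->|a1] := alive01 w u; first by rewrite mulr0 lexx expR_ge0.
have h : alive w u != 0 by rewrite a1 oner_eq0.
have /andP[A0 le] := alive_weight h; rewrite a1 mulr1 A0/=.
rewrite (le_trans le)// ler_expR.
have : walk w u <= del * (size u + K)%:R.
  move: h; case/lastP: u {le A0 a1} => [|u b].
    by rewrite /walk /= big_nil mulr_ge0// ltW.
  rewrite alive_rcons !mulf_eq0 !negb_or => /and3P[_ _].
  by rewrite /low indicE pnatr_eq0 eqb0 negbK inE/= in_itv/= size_rcons.
by rewrite natrD; lra.
Qed.

End pruning.

Section measurability.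
Context {d : measure_display} {T : measurableType d} {R : realType}.
Variables (eta del : R) (K : nat) (m : nat -> R) (X : seq bool -> T -> R).

Lemma measurable_clip_log k : measurable_fun [set: R] (clip_log eta del k).
Proof.
apply: measurable_minr => //; apply: measurableT_comp => //.
exact: measurable_maxr.
Qed.

Lemma measurable_small_weight k :
  measurable_fun [set: R] (small_weight del k).
Proof. exact: measurable_indic. Qed.

Lemma measurable_low k : measurable_fun [set: R] (low del k).
Proof. exact: measurable_indic. Qed.

Let W t v := X v t.

(** Only the coordinates at prefixes of [u] are assumed measurable, so that the lemma also applies
    over the sigma-algebra of the first generations. *)
Lemma measurable_cascade_weight u :
  (forall k, (0 < k <= size u)%N -> measurable_fun setT (X (take k u))) ->
  measurable_fun setT (fun t => cascade_weight (W t) u).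
Proof.
elim/last_ind: u => [|u b IH] mX.
  by rewrite /cascade_weight /=; under eq_fun do rewrite big_nil; exact: measurable_cst.
under eq_fun do rewrite cascade_weight_rcons.
rewrite size_rcons in mX.
apply: measurable_funM.
  apply: measurable_funM => //; apply: IH => k /andP[k0 ku].
  by have := mX k; rewrite -cats1 takel_cat// k0 leqW// => /(_ isT).
have := mX (size u).+1.
by rewrite -[X in take X](size_rcons u b) take_size => /(_ (leqnn _)).
Qed.

Lemma measurable_walk u :
  (forall k, (0 < k <= size u)%N -> measurable_fun setT (X (take k u))) ->
  measurable_fun setT (fun t => walk eta del K m (W t) u).
Proof.
elim/last_ind: u => [|u b IH] mX.
  by rewrite /walk /=; under eq_fun do rewrite big_nil; exact: measurable_cst.
under eq_fun do rewrite walk_rcons.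
rewrite size_rcons in mX.
apply: measurable_funD.
  apply: IH => k /andP[k0 ku].
  by have := mX k; rewrite -cats1 takel_cat// k0 leqW// => /(_ isT).
apply: measurable_funB => //.
apply: measurableT_comp; first exact: measurable_clip_log.
have := mX (size u).+1.
by rewrite -[X in take X](size_rcons u b) take_size => /(_ (leqnn _)).
Qed.

Lemma measurable_alive u :
  (forall k, (0 < k <= size u)%N -> measurable_fun setT (X (take k u))) ->
  measurable_fun setT (fun t => alive eta del K m (W t) u).
Proof.
elim/last_ind: u => [|u b IH] mX.
  by rewrite /alive /=; under eq_fun do rewrite big_nil; exact: measurable_cst.
under eq_fun do rewrite alive_rcons.
have mwalk := measurable_walk mX.
rewrite size_rcons in mX.
apply: measurable_funM.
  apply: IH => k /andP[k0 ku].
  by have := mX k; rewrite -cats1 takel_cat// k0 leqW// => /(_ isT).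
apply: measurable_funM; apply: measurableT_comp => //.
- exact: measurable_small_weight.
- have := mX (size u).+1.
  by rewrite -[X in take X](size_rcons u b) take_size => /(_ (leqnn _)).
- exact: measurable_low.
Qed.

End measurability.

(** Multiply by [1 - x > 0]: the left side becomes at most [1] because [1 - x <= expR (- x)], the
    right side at least [1]. *)
Lemma expR_le_quadratic (R : realType) (x : R) :
  x <= 1 / 2 -> expR x <= 1 + x + 2 * x ^+ 2.
Proof.
move=> x2; have x1 : 0 < 1 - x by lra.
have h : expR x * (1 - x) <= 1.
  rewrite -[leRHS](expRxMexpNx_1 x) ler_pM2l ?expR_gt0//.
  by have := expR_ge1Dx (- x); lra.
rewrite -(ler_pM2r x1) (le_trans h)//.
have -> : (1 + x + 2 * x ^+ 2) * (1 - x) = 1 + x ^+ 2 * (1 - 2 * x) by ring.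
by rewrite lerDl mulr_ge0 ?sqr_ge0//; lra.
Qed.

(** * Moments of the clipped logarithm under the size-biased law *)

Section weight_law.
Context {R : realType}.
Variables (La : probability (measurableTypeR R) R) (eta del : R).
Hypotheses (eta0 : 0 < eta) (eta1 : eta <= 1) (del0 : 0 < del).

Local Notation lnmax y := (ln (Num.max y eta)).

Hypothesis La_ge0 : {ae La, forall y, 0 <= y}.
Hypothesis La_mean : (\int[La]_y `|y|%:E = 1)%E.
Hypothesis La_log : (\int[La]_y (`|y| * `|lnmax y|)%:E < +oo)%E.
Hypothesis La_drift : (\int[La]_y (`|y| * lnmax y)%:E <= (ln 2 - 2 * del)%:E)%E.

(* As [La] is carried by the nonnegative reals and has mean [1], the density
   [`|y|] defines the size-biased law. *)
Definition biased_mean (g : R -> R) : R := \int[La]_y (`|y| * g y).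

Let mabs : measurable_fun [set: measurableTypeR R] (fun y : R => `|y|).
Proof. exact: measurableT_comp. Qed.

Let mlnmax : measurable_fun [set: measurableTypeR R] (fun y : R => lnmax y).
Proof. by apply: measurableT_comp => //; exact: measurable_maxr. Qed.

Lemma biased_integrable (g : R -> R) (C : R) : measurable_fun setT g ->
  (forall y, `|g y| <= C) ->
  La.-integrable setT (EFin \o (fun y => `|y| * g y)).
Proof.
move=> mg gC; have C0 : 0 <= C := le_trans (normr_ge0 _) (gC 0).
apply: (@le_integrable _ _ R La setT measurableT _ (EFin \o (fun y : R => C * `|y|))) => //.
- by apply/measurable_EFinP; apply: measurable_funM.
- move=> y _ /=; rewrite lee_fin normrM normr_id normrM normr_id mulrC.
  by rewrite ler_wpM2r// (le_trans (gC y)) ?ler_norm.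
- apply/integrableP; split.
    by apply/measurable_EFinP; apply: measurable_funM.
  under eq_integral do rewrite /= normrM normr_id (ger0_norm C0) EFinM.
  rewrite ge0_integralZl_EFin//; first by rewrite La_mean mule1 ltry.
  exact/measurable_EFinP.
Qed.

Lemma biased_meanE (g : R -> R) (C : R) : measurable_fun setT g ->
  (forall y, `|g y| <= C) ->
  (\int[La]_y (`|y| * g y)%:E = (biased_mean g)%:E)%E.
Proof.
move=> mg gC; rewrite /biased_mean /Rintegral fineK//.
exact: (integrable_fin_num measurableT (biased_integrable mg gC)).
Qed.

Lemma biased_mean_cst (c : R) : biased_mean (fun=> c) = c.
Proof.
apply: EFin_inj; rewrite -(@biased_meanE _ `|c|)//.
under eq_integral do rewrite EFinM muleC.
rewrite (@integralZl _ _ R La setT measurableT (fun y : R => (`|y|%:E))) ?La_mean ?mule1//.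
have -> : (fun y : R => (`|y|)%:E) = EFin \o (fun y => `|y| * (fun=> 1) y).
  by apply/funext => y /=; rewrite mulr1.
by apply: (@biased_integrable _ 1) => // y; rewrite normr1.
Qed.

Lemma biased_meanD (f g : R -> R) (C C' : R) :
  measurable_fun setT f -> (forall y, `|f y| <= C) ->
  measurable_fun setT g -> (forall y, `|g y| <= C') ->
  biased_mean (fun y => f y + g y) = biased_mean f + biased_mean g.
Proof.
move=> mf fC mg gC; rewrite /biased_mean -RintegralD//; last 2 first.
- exact: biased_integrable fC.
- exact: biased_integrable gC.
by apply: eq_Rintegral => y _; rewrite mulrDr.
Qed.

Lemma biased_meanZ (f : R -> R) (C c : R) :
  measurable_fun setT f -> (forall y, `|f y| <= C) ->
  biased_mean (fun y => c * f y) = c * biased_mean f.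
Proof.
move=> mf fC; rewrite /biased_mean -RintegralZl//; last first.
  exact: biased_integrable fC.
by apply: eq_Rintegral => y _; rewrite mulrCA.
Qed.

Lemma clip_log_bound k (y : R) :
  `|clip_log eta del k y| <= `|ln eta| + del / 2 * k%:R.
Proof.
have dk : 0 <= del / 2 * k%:R by rewrite !mulr_ge0// ltW.
have le : ln eta <= lnmax y by rewrite ler_ln ?posrE// ?lt_max ?eta0 ?orbT// le_max lexx orbT.
have : - `|ln eta| <= ln eta by rewrite lerNl -normrN ler_norm.
have := normr_ge0 (ln eta).
rewrite /clip_log ler_norml /Num.min; case: ifPn; rewrite -?leNgt => h1 h2 h3.
  by apply/andP; split; lra.
by apply/andP; split; lra.
Qed.

Definition clip_mean k : R := biased_mean (clip_log eta del k).

Definition clip_square k : R :=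
  biased_mean (fun y => clip_log eta del k y ^+ 2).

(** For a nonnegative weight of mean [1] this is the mean lost by truncation, so the truncated
    weight has mean [1 - large_mean k]. *)
Definition large_mean k : R :=
  biased_mean (fun y => 1 - small_weight del k y).

Lemma small_weight01 k (y : R) : small_weight del k y = 0 \/ small_weight del k y = 1.
Proof. by rewrite /small_weight indicE; case: (_ \in _); [right|left]. Qed.

Let clip2_bound k (y : R) :
  `|clip_log eta del k y ^+ 2| <= (`|ln eta| + del / 2 * k%:R) ^+ 2.
Proof.
rewrite normrX lerXn2r ?nnegrE ?clip_log_bound//.
exact: le_trans (normr_ge0 _) (clip_log_bound k 0).
Qed.

Let mclip2 k : measurable_fun setT (fun y : R => clip_log eta del k y ^+ 2).
Proof. by apply: measurable_funX; exact: measurable_clip_log. Qed.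

Let msmall k : measurable_fun setT (fun y : R => 1 - small_weight del k y).
Proof. by apply: measurable_funB => //; exact: measurable_small_weight. Qed.

Let small_bound k (y : R) : `|1 - small_weight del k y| <= 1.
Proof. by case: (small_weight01 k y) => ->; rewrite ?subrr ?subr0 ?normr0 ?normr1. Qed.

(** The cap only lowers the logarithm, so the drift bound holds at every level. *)
Lemma clip_mean_le k : clip_mean k <= ln 2 - 2 * del.
Proof.
rewrite -lee_fin (le_trans _ La_drift)// -(biased_meanE _ (clip_log_bound k)); last exact: measurable_clip_log.
apply: le_integral => //.
- exact: (biased_integrable (measurable_clip_log _ _ _) (clip_log_bound k)).
- apply/integrableP; split; first by apply/measurable_EFinP/measurable_funM.
  by under eq_integral do rewrite /= normrM normr_id.
- by move=> y _; rewrite lee_fin ler_wpM2l// /clip_log ge_min lexx.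
Qed.

(** Centering removes the cross term, and the variance is at most the second moment. Here [t] is the
    value of the walk at the parent. *)
Lemma biased_mean_step k (t : R) :
  biased_mean (fun y => (t + (clip_log eta del k y - clip_mean k)) ^+ 2) <=
  t ^+ 2 + clip_square k.
Proof.
set c := t - clip_mean k.
have -> : (fun y => (t + (clip_log eta del k y - clip_mean k)) ^+ 2) =
  (fun y => (c ^+ 2 + 2 * c * clip_log eta del k y) + clip_log eta del k y ^+ 2).
  by apply/funext => y; rewrite /c; ring.
set C := `|ln eta| + del / 2 * k%:R.
have bc y : `|2 * c * clip_log eta del k y| <= `|2 * c| * C.
  by rewrite normrM ler_wpM2l// clip_log_bound.
have mc : measurable_fun setT (fun y : R => 2 * c * clip_log eta del k y).
  by apply: measurable_funM => //; exact: measurable_clip_log.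
rewrite (@biased_meanD _ _ (c ^+ 2 + `|2 * c| * C) _ _ _ (mclip2 k) (clip2_bound k)); last 2 first.
- exact: measurable_funD.
- by move=> y; rewrite (le_trans (ler_normD _ _))// lerD// ger0_norm ?sqr_ge0.
rewrite (@biased_meanD (fun=> c ^+ 2) _ _ _ (measurable_cst _) (fun=> lexx _) mc bc)//.
rewrite biased_mean_cst (biased_meanZ _ (measurable_clip_log _ _ _) (clip_log_bound k)).
rewrite -/(clip_mean k) -/(clip_square k) lerD2r /c.
by have := sqr_ge0 (clip_mean k); lra.
Qed.

Let large_mean_compl k : biased_mean (small_weight del k) = 1 - large_mean k.
Proof.
rewrite -(biased_mean_cst 1) /large_mean.
have ms := @measurable_small_weight R del k.
have bs y : `|small_weight del k y| <= 1.
  by case: (small_weight01 k y) => ->; rewrite ?normr0 ?normr1.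
have -> : (fun y => 1 - small_weight del k y) =
          (fun y => (fun=> 1) y + (-1) * small_weight del k y).
  by apply/funext => y; rewrite mulN1r.
rewrite (@biased_meanD (fun=> 1) _ `|1| 1)//; last 2 first.
- exact: measurable_funM.
- by move=> y; rewrite normrM normrN1 mul1r.
by rewrite (biased_meanZ _ ms bs) biased_mean_cst; ring.
Qed.

Lemma large_mean_ge0 k : 0 <= large_mean k.
Proof.
apply: Rintegral_ge0 => y _; rewrite mulr_ge0//.
by case: (small_weight01 k y) => ->; rewrite ?subrr ?subr0.
Qed.

Lemma truncated_weight_bound k (y : R) :
  0 <= y * small_weight del k y <= expR (del / 2 * k%:R).
Proof.
rewrite /small_weight indicE; case: (boolP (_ \in _)) => [|_]; last by rewrite mulr0 lexx expR_ge0.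
by rewrite inE/= in_itv/= mulr1.
Qed.

(** The truncated weight [V] satisfies [0 <= V <= tau], hence [V ^ 2 <= tau * V]: the quadratic term
    of the exponential is controlled by the first moment, which is at most [1]. *)
Lemma mgf_truncated_weight k (a : R) : `|a| * expR (del / 2 * k%:R) <= 1 / 2 ->
  (\int[La]_y (expR (a * (y * small_weight del k y - (1 - large_mean k))))%:E <=
   (expR (2 * a ^+ 2 * expR (del / 2 * k%:R)))%:E)%E.
Proof.
set tau := expR _ => atau.
set c := 1 - large_mean k.
pose h y := (a + 2 * a ^+ 2 * tau) * small_weight del k y.
have mh : measurable_fun setT h.
  by apply: measurable_funM => //; exact: measurable_small_weight.
have ms := @measurable_small_weight R del k.
have bs y : `|small_weight del k y| <= 1.
  by case: (small_weight01 k y) => ->; rewrite ?normr0 ?normr1.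
have bh y : `|h y| <= `|a + 2 * a ^+ 2 * tau|.
  by rewrite /h normrM ler_piMr.
have mV : measurable_fun [set: measurableTypeR R]
    (fun y : R => a * (y * small_weight del k y - c)).
  by apply: measurable_funM => //; apply: measurable_funB => //; exact: measurable_funM.
have le1 y : expR (a * (y * small_weight del k y - c)) <=
    expR (- (a * c)) * (1 + `|y| * h y).
  rewrite mulrBr addrC expRD ler_pM2l ?expR_gt0//.
  have /andP[V0 Vt] := truncated_weight_bound k y.
  have VE : `|y| * small_weight del k y = y * small_weight del k y.
    rewrite -[RHS]ger0_norm// normrM; congr (_ * _).
    by rewrite ger0_norm//; case: (small_weight01 k y) => ->.
  rewrite /h [X in _ <= _ + X]mulrCA VE; set V := y * _ in V0 Vt *.
  apply: le_trans (expR_le_quadratic _) _.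
    apply: (le_trans (ler_norm _)); rewrite normrM (ger0_norm V0).
    by rewrite (le_trans _ atau)// ler_wpM2l.
  have : 2 * (a * V) ^+ 2 <= 2 * a ^+ 2 * tau * V.
    rewrite exprMn mulrA -[leRHS]mulrA ler_wpM2l//.
      by rewrite mulr_ge0// sqr_ge0.
    by rewrite expr2 ler_wpM2r.
  by lra.
apply: (@le_trans _ _ (\int[La]_y ((expR (- (a * c)))%:E * (1 + `|y| * h y)%:E))%E).
  apply: ge0_le_integral => //.
  - by apply/measurable_EFinP; exact: measurableT_comp.
  - apply/measurable_EFinP; apply: measurable_funM => //.
    by apply: measurable_funD => //; exact: measurable_funM.
  - by move=> y _; rewrite -EFinM lee_fin.
have ih := biased_integrable mh bh.
rewrite integralZl//; last first.
  rewrite (_ : (fun y => _) = (EFin \o (fun y => 1 + `|y| * h y)))//.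
  rewrite (_ : EFin \o _ = (cst 1%E \+ (EFin \o (fun y => `|y| * h y))))//.
  by apply: integrableD => //; exact: finite_measure_integrable_cst.
under eq_integral do rewrite EFinD.
rewrite integralD//; last exact: finite_measure_integrable_cst.
have -> : (\int[La]_y 1%:E = 1)%E.
  by rewrite integral_cst// mul1e; exact: probability_setT.
rewrite (biased_meanE mh bh).
rewrite -EFinD -EFinM lee_fin (biased_meanZ _ ms bs) large_mean_compl -/c.
rewrite mulrC -ler_pdivlMr ?expR_gt0// -expRN opprK -expRD.
apply: le_trans (expR_ge1Dx _).
have : 2 * a ^+ 2 * tau * c <= 2 * a ^+ 2 * tau.
  rewrite ler_piMr//; first by rewrite mulr_ge0 ?expR_ge0// mulr_ge0// sqr_ge0.
  by rewrite /c lerBlDr lerDl large_mean_ge0.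
lra.
Qed.

(** Cost of level [k]: the first term pays for failing [small_weight], the second is the variance
    increment of the walk relative to the squared threshold of [low]. *)
Definition kill_rate k : R := large_mean k + clip_square k / (del * k%:R) ^+ 2.

Lemma kill_rate_ge0 k : 0 <= kill_rate k.
Proof.
rewrite addr_ge0 ?large_mean_ge0// divr_ge0 ?sqr_ge0//.
by apply: Rintegral_ge0 => y _; rewrite mulr_ge0// sqr_ge0.
Qed.

(** The [k] at which the cap [del / 2 * k] equals the absolute logarithm: a large weight is cut
    exactly at the levels below it. *)
Let D y := 2 * `|lnmax y| / del.

Let kill_term k y :=
  1 - small_weight del k y + clip_log eta del k y ^+ 2 / (del * k%:R) ^+ 2.

Let D0 y : 0 <= D y. Proof. by rewrite /D divr_ge0 ?mulr_ge0// ltW. Qed.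

Let kill_term_ge0 k y : 0 <= kill_term k y.
Proof.
rewrite addr_ge0// ?divr_ge0 ?sqr_ge0//.
by case: (small_weight01 k y) => ->; rewrite ?subrr ?subr0.
Qed.

(* With [z = D y], [kill_term k y] is of order [(z / (z + k)) ^ 2], which
   telescopes against [z ^ 2 / (z + k)]; the sum over [k] is then linear in [z],
   so that integrability of [W log W] suffices. *)
Let kill_term_le j (y : R) : 0 <= y -> (0 < j)%N -> `|ln eta| * 2 / del <= j%:R ->
  kill_term j.+1 y <= 5 * (D y ^+ 2 / (D y + j%:R) - D y ^+ 2 / (D y + j.+1%:R)).
Proof.
move=> y0 j0 jL; set k : R := j.+1%:R.
have j0' : 0 < j%:R :> R by rewrite ltr0n.
have kj : k = j%:R + 1 by rewrite /k -addn1 natrD.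
have k0 : 0 < k by rewrite kj; lra.
have Dj : 0 < D y + j%:R by rewrite ltr_wpDl.
have Dk : 0 < D y + k by rewrite ltr_wpDl.
apply: (@le_trans _ _ (5 * (D y / (D y + k)) ^+ 2)); last first.
  rewrite ler_pM2l//.
  have -> : D y ^+ 2 / (D y + j%:R) - D y ^+ 2 / (D y + k) =
      D y ^+ 2 / ((D y + j%:R) * (D y + k)).
    by rewrite kj; field; rewrite -kj !gt_eqF.
  rewrite expr_div_n ler_wpM2l ?sqr_ge0// lef_pV2 ?posrE ?mulr_gt0 ?exprn_gt0//.
  by rewrite expr2 ler_pM2r// lerD2l kj; lra.
have ye : 0 < Num.max y eta by rewrite lt_max eta0 orbT.
rewrite /kill_term -/k.
have [yk|yk] := leP y (expR (del / 2 * k)).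
- have -> : small_weight del j.+1 y = 1.
    by rewrite /small_weight indicE mem_set//= in_itv/= y0.
  have lk : lnmax y <= del / 2 * k.
    rewrite -ler_expR lnK ?posrE// ge_max yk (le_trans eta1)//.
    by rewrite -[leLHS]expR0 ler_expR !mulr_ge0// ltW.
  have -> : clip_log eta del j.+1 y = lnmax y by rewrite /clip_log; apply/min_idPl.
  have lD : lnmax y ^+ 2 = (del / 2 * D y) ^+ 2.
    rewrite /D -real_normK ?num_real//; congr (_ ^+ 2).
    by field; rewrite gt_eqF.
  (* The lower bound on [j] serves here: a negative logarithm is at least [ln eta], hence also
     within [del / 2 * k]. *)
  have Dk' : D y <= k.
    rewrite /D ler_pdivrMr// mulrC -ler_pdivlMr// ler_norml.
    have : `|ln eta| <= del * k / 2.
      move: jL; rewrite ler_pdivrMr// ler_pdivlMr// => jL; rewrite (le_trans jL)// kj.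
      by rewrite mulrC ler_pM2l// lerDl.
    have : ln eta <= lnmax y by rewrite ler_ln ?posrE// le_max lexx orbT.
    have : - `|ln eta| <= ln eta by rewrite lerNl -normrN ler_norm.
    by move=> h1 h2 h3; apply/andP; split; lra.
  rewrite subrr add0r lD.
  have -> : (del / 2 * D y) ^+ 2 / (del * k) ^+ 2 = (D y / (2 * k)) ^+ 2.
    by field; rewrite !gt_eqF.
  apply: (@le_trans _ _ ((D y / (D y + k)) ^+ 2)); last first.
    by rewrite ler_peMl ?sqr_ge0//; lra.
  have h1 : 0 <= D y / (2 * k) by apply: divr_ge0 => //; apply: mulr_ge0 => //; exact: ltW.
  have h2 : 0 <= D y / (D y + k) by apply: divr_ge0 => //; exact: ltW.
  rewrite lerXn2r ?nnegrE//.
  by rewrite ler_wpM2l// lef_pV2 ?posrE ?mulr_gt0//; lra.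
- have -> : small_weight del j.+1 y = 0.
    rewrite /small_weight indicE memNset//= in_itv/= => /andP[_].
    by rewrite leNgt yk.
  have lk : del / 2 * k < lnmax y.
    by rewrite -ltr_expR lnK ?posrE// lt_max yk.
  have -> : clip_log eta del j.+1 y = del / 2 * k.
    by rewrite /clip_log; apply/min_idPr/ltW.
  have -> : (del / 2 * k) ^+ 2 / (del * k) ^+ 2 = 1 / 4.
    by field; rewrite !gt_eqF.
  have l0 : 0 < lnmax y by rewrite (lt_trans _ lk)// !mulr_gt0.
  have Dk' : k < D y.
    by rewrite /D gtr0_norm// ltr_pdivlMr//; lra.
  (* Origin of the factor [5]: the left side of the goal is [1 + 1 / 4], while [k < D y] makes the
     squared ratio at least [1 / 4]. *)
  have : (1 / 2) ^+ 2 <= (D y / (D y + k)) ^+ 2.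
    have h2 : 0 <= D y / (D y + k) by apply: divr_ge0 => //; exact: ltW.
    rewrite lerXn2r ?nnegrE//.
    by rewrite ler_pdivlMr//; lra.
  by rewrite subr0; lra.
Qed.

Let mkill_term k : measurable_fun setT (kill_term k).
Proof. by apply: measurable_funD => //; exact: measurable_funM. Qed.

(** The sum is taken under the integral, where [kill_term_le] telescopes to at most [5 * D y];
    [La_log] makes this integrable. The first levels are dropped because [kill_term_le] needs a
    large index. *)
Lemma kill_rate_sum : exists C N0, forall n, \sum_(N0 <= k < n) kill_rate k <= C.
Proof.
have [j [j0 jL]] : exists j, (0 < j)%N /\ `|ln eta| * 2 / del <= j%:R.
  exists (Num.truncn (`|ln eta| * 2 / del)).+1; split => //.
  exact/ltW/truncnS_gt.
pose C := (\int[La]_y ((10 / del) * (`|y| * `|lnmax y|))%:E)%E.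
have Cfin : C \is a fin_num.
  rewrite ge0_fin_numE; last first.
    by apply: integral_ge0 => y _; rewrite lee_fin !mulr_ge0// invr_ge0 ltW.
  rewrite /C; under eq_integral do rewrite EFinM.
  rewrite ge0_integralZl_EFin//.
  - by rewrite lte_mul_pinfty// lee_fin divr_ge0// ltW.
  - apply/measurable_EFinP; apply: measurable_funM => //.
    exact: measurableT_comp.
  - by rewrite divr_ge0// ltW.
exists (fine C), j.+1 => n.
rewrite -lee_fin (fineK Cfin) -sumEFin.
have rateE k : ((kill_rate k)%:E = \int[La]_y (`|y| * kill_term k y)%:E)%E.
  have bk y : `|clip_log eta del k y ^+ 2 / (del * k%:R) ^+ 2| <=
      (`|ln eta| + del / 2 * k%:R) ^+ 2 / (del * k%:R) ^+ 2.
    rewrite normrM (ger0_norm (_ : 0 <= (_ ^+ 2)^-1)) ?invr_ge0 ?sqr_ge0//.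
    by rewrite ler_wpM2r ?invr_ge0 ?sqr_ge0.
  have mk : measurable_fun setT (fun y => clip_log eta del k y ^+ 2 / (del * k%:R) ^+ 2).
    exact: measurable_funM.
  rewrite (@biased_meanE _ (1 + (`|ln eta| + del / 2 * k%:R) ^+ 2 / (del * k%:R) ^+ 2))//.
    rewrite /kill_term (biased_meanD (msmall k) (small_bound k) mk bk); congr (_ + _)%:E.
    rewrite /kill_rate; under [in RHS]eq_fun do rewrite mulrC.
    by rewrite (biased_meanZ _ (mclip2 k) (clip2_bound k)) mulrC.
  by move=> y; rewrite (le_trans (ler_normD _ _))// lerD.
under eq_bigr do rewrite rateE.
rewrite -ge0_integral_sum//; last 2 first.
- by move=> k; apply/measurable_EFinP; apply: measurable_funM => //; exact: mkill_term.
- by move=> k y _; rewrite lee_fin mulr_ge0.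
apply: ae_ge0_le_integral => //.
- by move=> y _; apply: sume_ge0 => k _; rewrite lee_fin mulr_ge0.
- by apply: emeasurable_sum => k; apply/measurable_EFinP; apply: measurable_funM => //; exact: mkill_term.
- by move=> y _; rewrite lee_fin !mulr_ge0// invr_ge0 ltW.
- apply/measurable_EFinP; apply: measurable_funM => //.
  apply: measurable_funM => //; exact: measurableT_comp.
apply: (@filterS _ _ (ae_filter_ringOfSetsType La) _ _ _ La_ge0) => y y0 _; rewrite sumEFin lee_fin -mulr_sumr.
have -> : 10 / del * (`|y| * `|lnmax y|) = `|y| * (5 * D y).
  by rewrite /D; field; rewrite gt_eqF.
rewrite ler_wpM2l//.
have [nj|jn] := leqP n j.+1.
  by rewrite big_geq// mulr_ge0.
have n0 : (0 < n)%N by rewrite (leq_trans _ jn).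
rewrite -(prednK n0) big_add1 /=.
apply: (@le_trans _ _ (\sum_(j <= i < n.-1)
    5 * (D y ^+ 2 / (D y + i%:R) - D y ^+ 2 / (D y + i.+1%:R)))).
  apply: ler_sum_nat => i /andP[ji _]; apply: kill_term_le => //.
    exact: leq_trans j0 ji.
  by rewrite (le_trans jL)// ler_nat.
rewrite -mulr_sumr ler_pM2l//.
have jn' : (j <= n.-1)%N by rewrite -ltnS prednK// ltnW.
rewrite (@telescope_sumr_eq _ _ _ (fun i => - (D y ^+ 2 / (D y + i%:R))))//; last first.
  by move=> k _; rewrite opprK addrC.
have Dj : 0 < D y + j%:R by rewrite ltr_wpDl// ltr0n.
rewrite opprK addrC; apply: (@le_trans _ _ (D y ^+ 2 / (D y + j%:R))).
  by rewrite gerBl divr_ge0 ?sqr_ge0// addr_ge0.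
by rewrite ler_pdivrMr// expr2 ler_wpM2l// lerDl.
Qed.

End weight_law.

(** * Expectation of the killed mass *)

Section cascade_expectation.
Context {d : measure_display} {T : measurableType d} {R : realType}.
Variables (P : probability T R) (X : seq bool -> {RV P >-> R}).
Variables (La : probability (measurableTypeR R) R) (eta del : R) (K : nat).
Hypothesis X_indep : mutually_independent nonempty_words X.
Hypothesis X_law : forall u, u != [::] -> forall B : set R, measurable B ->
  P (X u @^-1` B) = La B.
Hypotheses (eta0 : 0 < eta) (eta1 : eta <= 1) (del0 : 0 < del) (K0 : (0 < K)%N).
Hypothesis La_mean : (\int[La]_y `|y|%:E = 1)%E.

Let W t u := X u t.

Definition short_words (n : nat) : set (seq bool) :=
  [set v | (0 < size v <= n)%N].

Local Notation A t u := (cascade_weight (W t) u).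
Local Notation m := (clip_mean La eta del).
Local Notation wk t u := (walk eta del K m (W t) u).
Local Notation al t u := (alive eta del K m (W t) u).
Local Notation past J := (g_sigma_algebraType (cylinders X J)).

Lemma integral_fresh_words (J : set (seq bool)) v
    (f : past J * measurableTypeR R -> \bar R) :
  J `<=` nonempty_words -> v != [::] -> ~ J v ->
  measurable_fun [set: past J * measurableTypeR R] f ->
  (forall z, (0 <= f z)%E) ->
  (\int[P]_t f (t, X v t) = \int[P]_t \int[La]_y f (t, y))%E.
Proof. by move=> *; exact: (integral_fresh X_indep). Qed.

Lemma short_words_nonempty n : short_words n `<=` nonempty_words.
Proof. by move=> v /andP[v0 _]; rewrite /nonempty_words /= -size_eq0 -lt0n. Qed.

Section measurability_past.
Variables (J : set (seq bool)) (n : nat) (u : seq bool).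
Hypotheses (Jn : short_words n `<=` J) (un : (size u <= n)%N).

Let mX k : (0 < k <= size u)%N ->
  measurable_fun [set: past J] (X (take k u) : _ -> R).
Proof.
move=> /andP[k0 ku]; apply: measurable_coordinate; apply: Jn.
by rewrite /short_words /= size_take_min (minn_idPl ku) k0 (leq_trans ku un).
Qed.

Lemma measurable_past_weight : measurable_fun [set: past J] (fun t => A t u).
Proof. exact: measurable_cascade_weight. Qed.

Lemma measurable_past_walk : measurable_fun [set: past J] (fun t => wk t u).
Proof. exact: measurable_walk. Qed.

Lemma measurable_past_alive : measurable_fun [set: past J] (fun t => al t u).
Proof. exact: measurable_alive. Qed.

End measurability_past.

Let mX_ v : measurable_fun setT (X v : T -> R). Proof. exact: measurable_funP. Qed.

Lemma measurable_weight u : measurable_fun setT (fun t => A t u).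
Proof. exact: measurable_cascade_weight. Qed.

Lemma measurable_walk_ u : measurable_fun setT (fun t => wk t u).
Proof. exact: measurable_walk. Qed.

Lemma measurable_alive_ u : measurable_fun setT (fun t => al t u).
Proof. exact: measurable_alive. Qed.

Lemma fresh_child u b : ~ short_words (size u) (rcons u b).
Proof. by rewrite /short_words /= size_rcons ltnn andbF. Qed.

Lemma rcons_neq0 (u : seq bool) b : rcons u b != [::].
Proof. by rewrite -size_eq0 size_rcons. Qed.

(** Absolute values stand in for the weights, which are nonnegative only almost surely; the fresh
    factor then integrates to [1] by [La_mean]. *)
Lemma expect_child_weight u b (h : T -> R) :
  measurable_fun [set: past (short_words (size u))] h ->
  (forall t, 0 <= h t) ->
  (\int[P]_t (`|A t (rcons u b)| * h t)%:E =
   (1 / 2)%:E * \int[P]_t (`|A t u| * h t)%:E)%E.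
Proof.
move=> mh h0.
under eq_integral do rewrite cascade_weight_rcons.
have mA := measurable_past_weight (@subset_refl _ (short_words (size u))) (leqnn _).
pose f (z : past (short_words (size u)) * measurableTypeR R) : \bar R :=
  (`|A z.1 u / 2 * z.2| * h z.1)%:E.
rewrite (@integral_fresh_words _ (rcons u b) f (@short_words_nonempty _)) ?rcons_neq0//; last 3 first.
- exact: fresh_child.
- apply/measurable_EFinP; apply: measurable_funM.
    apply: measurableT_comp => //; apply: measurable_funM => //.
    apply: measurable_funM => //.
    exact: (measurableT_comp mA (measurable_fst)).
  exact: (measurableT_comp mh (measurable_fst)).
- by move=> z; rewrite lee_fin mulr_ge0.
rewrite -ge0_integralZl_EFin//; last 2 first.
- by move=> t _; rewrite lee_fin mulr_ge0.
- apply/measurable_EFinP; apply: (@measurable_from_cylinders _ _ _ _ _ X _ _ (short_words (size u))).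
  by apply: measurable_funM; [apply: measurableT_comp; [|exact: mA]|exact: mh].
apply: eq_integral => t _; rewrite /f /=.
have -> : (fun y => (`|A t u / 2 * y| * h t)%:E) =
    (fun y : R => (`|A t u| / 2 * h t)%:E * `|y|%:E)%E.
  apply/funext => y; rewrite -EFinM; congr (_%:E).
  by rewrite !normrM [`|2^-1|]ger0_norm//; ring.
rewrite ge0_integralZl_EFin//; last 2 first.
- by apply/measurable_EFinP; exact: normr_measurable.
- by rewrite mulr_ge0.
by rewrite La_mean mule1 -EFinM; congr (_%:E); ring.
Qed.

Lemma expect_norm_weight u :
  (\int[P]_t `|A t u|%:E = (2 ^- size u)%:E)%E.
Proof.
elim/last_ind: u => [|u b IH].
  under eq_integral do rewrite /cascade_weight /= big_nil mulr1 expr0 invr1 normr1.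
  by rewrite integral_cst// mul1e expr0 invr1; exact: probability_setT.
have := @expect_child_weight u b (fun=> 1) (measurable_cst _) (fun=> ler01).
under eq_integral do rewrite mulr1.
under [in X in _ = X -> _]eq_integral do rewrite mulr1.
move=> ->; rewrite IH size_rcons exprS -EFinM; congr (_%:E).
by rewrite invfM; ring.
Qed.

(** Dead mass counts fully, living mass by the Chebyshev ratio of its walk. Its expectation, unlike
    that of the dead mass alone, can be propagated from parent to child. *)
Definition potential t u : R :=
  `|A t u| * ((1 - al t u) + al t u * (wk t u ^+ 2 / (del * (size u + K)%:R) ^+ 2)).

Lemma potential_ge0 t u : 0 <= potential t u.
Proof.
rewrite mulr_ge0// addr_ge0// ?subr_ge0 ?alive_le1// mulr_ge0 ?alive_ge0//.
by rewrite divr_ge0// sqr_ge0.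
Qed.

Lemma measurable_potential u : measurable_fun setT (fun t => potential t u).
Proof.
have mA := measurable_weight u; have mw := measurable_walk_ u.
have ma := measurable_alive_ u.
apply: measurable_funM; first exact: measurableT_comp.
apply: measurable_funD; first exact: measurable_funB.
by apply: measurable_funM => //; apply: measurable_funM => //; exact: measurable_funX.
Qed.

(* A mass that fails [low] has [walk ^ 2] above the threshold, so the quadratic
   part of [potential] pays for it (Kolmogorov's maximal inequality under the
   size-biased law). *)
Lemma expect_child_potential u b :
  (\int[P]_t (potential t (rcons u b))%:E <=
   (1 / 2)%:E * (\int[P]_t (potential t u)%:E +
     (2 ^- size u * kill_rate La eta del ((size u).+1 + K))%:E))%E.
Proof.
set k := ((size u).+1 + K)%N.
pose s y := small_weight del k y.
pose t' t y := wk t u + (clip_log eta del k y - m k).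
pose q t y := t' t y ^+ 2 / (del * k%:R) ^+ 2.
pose f (z : past (short_words (size u)) * measurableTypeR R) : \bar R :=
  (`|A z.1 u / 2 * z.2| * ((1 - al z.1 u * (s z.2 * low del k (t' z.1 z.2))) +
     al z.1 u * (s z.2 * low del k (t' z.1 z.2)) * q z.1 z.2))%:E.
have mA := measurable_past_weight (@subset_refl _ (short_words (size u))) (leqnn _).
have mw := measurable_past_walk (@subset_refl _ (short_words (size u))) (leqnn _).
have ma := measurable_past_alive (@subset_refl _ (short_words (size u))) (leqnn _).
have mA1 := measurableT_comp mA (@measurable_fst _ _ _ (measurableTypeR R)).
have mw1 := measurableT_comp mw (@measurable_fst _ _ _ (measurableTypeR R)).
have ma1 := measurableT_comp ma (@measurable_fst _ _ _ (measurableTypeR R)).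
have ms : measurable_fun setT s by exact: measurable_small_weight.
have mc := @measurable_clip_log R eta del k.
have m2 := @measurable_snd _ _ (past (short_words (size u))) (measurableTypeR R).
have mt' : measurable_fun [set: past (short_words (size u)) * measurableTypeR R]
    (fun z => t' z.1 z.2).
  by apply: measurable_funD => //; apply: measurable_funB => //; exact: measurableT_comp.
have f0 z : (0 <= f z)%E.
  have l01 : 0 <= s z.2 * low del k (t' z.1 z.2) <= 1.
    by rewrite /s /small_weight /low !indicE; case: (_ \in _); case: (_ \in _); rewrite ?mulr1 ?mulr0 lexx ?ler01.
  have /andP[l0 l1] := l01.
  rewrite lee_fin mulr_ge0// addr_ge0//.
    by rewrite subr_ge0 mulr_ile1// ?alive_ge0 ?alive_le1.
  apply: mulr_ge0; first by apply: mulr_ge0 => //; exact: alive_ge0.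
  by rewrite divr_ge0// sqr_ge0.
have -> : (\int[P]_t (potential t (rcons u b))%:E = \int[P]_t f (t, X (rcons u b) t))%E.
  apply: eq_integral => t _; rewrite /potential /f cascade_weight_rcons alive_rcons.
  by rewrite walk_rcons size_rcons -/k.
have mf : measurable_fun [set: past (short_words (size u)) * measurableTypeR R] f.
  apply/measurable_EFinP; apply: measurable_funM.
    by apply: measurableT_comp => //; apply: measurable_funM => //; exact: measurable_funM.
  have ml : measurable_fun [set: past (short_words (size u)) * measurableTypeR R]
      (fun z => al z.1 u * (s z.2 * low del k (t' z.1 z.2))).
    apply: measurable_funM => //; apply: measurable_funM => //.
      exact: measurableT_comp.
    by apply: measurableT_comp => //; exact: measurable_low.
  apply: measurable_funD; first exact: measurable_funB.
  by apply: measurable_funM => //; apply: measurable_funM => //; exact: measurable_funX.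
rewrite (@integral_fresh_words _ (rcons u b) f (@short_words_nonempty _)) ?rcons_neq0//; last first.
  exact: fresh_child.
pose rate := kill_rate La eta del k.
have rate0 : 0 <= rate by exact: kill_rate_ge0.
have -> : ((2 ^- size u * rate)%:E = \int[P]_t (`|A t u| * rate)%:E)%E.
  under eq_integral do rewrite mulrC EFinM.
  rewrite ge0_integralZl_EFin//; last first.
    by apply/measurable_EFinP; apply: measurableT_comp => //; exact: measurable_weight.
  by rewrite expect_norm_weight -EFinM mulrC.
have mpot := measurable_potential u.
have mArate : measurable_fun setT (fun t => `|A t u| * rate).
  by apply: measurable_funM => //; apply: measurableT_comp => //; exact: measurable_weight.
rewrite -ge0_integralD//; last 4 first.
- by move=> t _; rewrite lee_fin potential_ge0.
- exact/measurable_EFinP.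
- by move=> t _; rewrite lee_fin mulr_ge0.
- exact/measurable_EFinP.
rewrite -ge0_integralZl_EFin//; last 2 first.
- by move=> t _; rewrite adde_ge0// lee_fin ?potential_ge0// mulr_ge0.
- by apply: emeasurable_funD; exact/measurable_EFinP.
apply: ge0_le_integral => //.
- by move=> t _; apply: integral_ge0.
- apply: (@measurable_from_cylinders _ _ _ _ _ X _ _ (short_words (size u))).
  exact: (measurable_fun_fubini_tonelli_F (m2 := La) f mf f0).
- apply: emeasurable_funM => //; apply: emeasurable_funD; exact/measurable_EFinP.
move=> t _; rewrite -EFinD -EFinM.
have c0 : 0 < del * k%:R by rewrite mulr_gt0// ltr0n.
have s01 y : s y = 0 \/ s y = 1 by exact: small_weight01.
have mq : measurable_fun setT (q t).
  apply: measurable_funM => //; apply: measurable_funX.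
  by apply: measurable_funD => //; exact: measurable_funB.
set C := `|ln eta| + del / 2 * k%:R.
have C0 : 0 <= C by rewrite addr_ge0// !mulr_ge0// ltW.
have bt' y : `|t' t y| <= `|wk t u| + (C + `|m k|).
  rewrite /t' (le_trans (ler_normD _ _))// lerD2l (le_trans (ler_normB _ _))// lerD2r.
  exact: clip_log_bound.
have bq y : `|q t y| <= (`|wk t u| + (C + `|m k|)) ^+ 2 / (del * k%:R) ^+ 2.
  rewrite /q normrM [X in _ * X]ger0_norm ?invr_ge0 ?sqr_ge0//.
  rewrite ler_wpM2r ?invr_ge0 ?sqr_ge0// normrX lerXn2r ?nnegrE ?bt'//.
  by rewrite addr_ge0// addr_ge0.
have bs y : `|1 - s y| <= 1 by case: (s01 y) => ->; rewrite ?subrr ?subr0 ?normr0 ?normr1.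
have ms1 : measurable_fun setT (fun y => 1 - s y) by exact: measurable_funB.
have [a0|a1] := alive01 eta del K m (W t) u.
  have -> : (fun y => f (t, y)) = (fun y : R => (`|A t u| / 2)%:E * `|y|%:E)%E.
    apply/funext => y; rewrite /f /= a0 !mul0r subr0 addr0 mulr1 -EFinM.
    by rewrite !normrM [`|2^-1|]ger0_norm.
  rewrite ge0_integralZl_EFin//; last first.
    by apply/measurable_EFinP; exact: normr_measurable.
  rewrite La_mean mule1 lee_fin /potential a0 mul0r subr0 addr0 mulr1.
  have := mulr_ge0 (normr_ge0 (A t u)) rate0; lra.
apply: (@le_trans _ _ (\int[La]_y ((`|A t u| / 2)%:E * (`|y| * (1 - s y + q t y))%:E))%E).
  apply: ge0_le_integral => //.
    exact: (@measurable_fun_pair2 _ _ _ (past (short_words (size u))) (measurableTypeR R) (\bar R) f t mf).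
  - apply: emeasurable_funM => //; apply/measurable_EFinP; apply: measurable_funM.
      exact: normr_measurable.
    exact: measurable_funD.
  - move=> y _; rewrite /f /= a1 -EFinM lee_fin !mul1r.
    rewrite normrM (normrM (A t u)) [`|2^-1|]ger0_norm// [leRHS]mulrA ler_wpM2l// ?mulr_ge0//.
    have q0 : 0 <= q t y by rewrite divr_ge0// sqr_ge0.
    rewrite /low indicE; case: (boolP (_ \in _)) => [_|].
      by rewrite mulr1; case: (s01 y) => ->; rewrite ?mul0r ?mul1r ?subrr ?subr0; lra.
    rewrite notin_setE/= in_itv/= => /negP; rewrite -ltNge => lt'.
    have : 1 <= q t y.
      rewrite /q -expr_div_n -[leLHS](expr1n _ 2) lerXn2r ?nnegrE//.
        by rewrite divr_ge0// ltW// (lt_trans c0).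
      by rewrite ler_pdivlMr// mul1r ltW.
    rewrite mulr0 mul0r subr0 addr0.
    by case: (s01 y) => ->; lra.
rewrite ge0_integralZl_EFin//; last 2 first.
- move=> y _; rewrite lee_fin mulr_ge0// addr_ge0//.
    by case: (s01 y) => ->; rewrite ?subrr ?subr0.
  by rewrite divr_ge0// sqr_ge0.
- apply/measurable_EFinP; apply: measurable_funM; first exact: normr_measurable.
  exact: measurable_funD.
rewrite (@biased_meanE _ _ La_mean _ (1 + (`|wk t u| + (C + `|m k|)) ^+ 2 / (del * k%:R) ^+ 2)); last 2 first.
- exact: measurable_funD.
- by move=> y; rewrite (le_trans (ler_normD _ _))// lerD.
rewrite -EFinM lee_fin (biased_meanD La_mean ms1 bs mq bq).
have qE : biased_mean La (q t) <= (wk t u ^+ 2 + clip_square La eta del k) / (del * k%:R) ^+ 2.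
  have -> : q t = (fun y => (del * k%:R) ^- 2 * t' t y ^+ 2).
    by apply/funext => y; rewrite mulrC.
  rewrite (@biased_meanZ _ _ La_mean (fun y => t' t y ^+ 2) ((`|wk t u| + (C + `|m k|)) ^+ 2)); last 2 first.
  - by apply: measurable_funX; apply: measurable_funD => //; exact: measurable_funB.
  - move=> y; rewrite normrX lerXn2r ?nnegrE ?bt'//.
    by rewrite addr_ge0// addr_ge0.
  rewrite [leRHS]mulrC ler_wpM2l// ?invr_ge0 ?sqr_ge0//.
  exact: biased_mean_step.
rewrite /potential a1 subrr add0r mul1r.
(* The larger threshold of the child lowers the ratio; [K0] keeps the threshold positive at the
   root. *)
have le2 : wk t u ^+ 2 / (del * k%:R) ^+ 2 <= wk t u ^+ 2 / (del * (size u + K)%:R) ^+ 2.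
  have c1 : 0 < del * (size u + K)%:R by rewrite mulr_gt0// ltr0n addn_gt0 K0 orbT.
  rewrite ler_wpM2l ?sqr_ge0// lef_pV2 ?posrE ?exprn_gt0//.
  rewrite lerXn2r ?nnegrE ?ltW// ltr_pM2l// ltr_nat.
  by rewrite /k addSn.
have : biased_mean La (fun y => 1 - s y) + biased_mean La (q t) <=
    wk t u ^+ 2 / (del * (size u + K)%:R) ^+ 2 + rate.
  rewrite /rate /kill_rate -/(large_mean La del k) /large_mean -/s.
  by rewrite mulrDl in qE; lra.
move/(ler_wpM2l (normr_ge0 (A t u))); lra.
Qed.

Lemma expect_potential u :
  (\int[P]_t (potential t u)%:E <=
   (2 ^- size u * \sum_(1 <= k < (size u).+1) kill_rate La eta del (k + K))%:E)%E.
Proof.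
elim/last_ind: u => [|u b IH].
  rewrite big_geq// mulr0 integral0_eq// => t _.
  by rewrite /potential /alive /walk /= !big_nil subrr add0r expr0n/= mul0r mulr0 mulr0.
apply: (le_trans (expect_child_potential u b)).
rewrite size_rcons big_nat_recr//=.
set r := kill_rate _ _ _ _; move: r => r.
apply: (@le_trans _ _ ((1 / 2)%:E * ((2 ^- size u *
   \sum_(1 <= k < (size u).+1) kill_rate La eta del (k + K))%:E +
   (2 ^- size u * r)%:E))%E).
  by apply: lee_wpmul2l => //; exact: leeD2r.
rewrite -!EFinD -EFinM lee_fin exprS invfM.
by set S := \sum_(_ <= _ < _) _; lra.
Qed.

Definition killed_mass n t : R :=
  \sum_(u <- words n) `|A t u| * (1 - al t u).

(** Mass of the dead words of level [n] whose parent is alive; this is the loss charged in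
    [pruned_step]. *)
Definition first_killed n t : R :=
  \sum_(v <- words n) `|A t v| * (al t (take n.-1 v) - al t v).

Lemma killed_mass_ge0 n t : 0 <= killed_mass n t.
Proof. by apply: sumr_ge0 => u _; rewrite mulr_ge0// subr_ge0 alive_le1. Qed.

Lemma measurable_killed_mass n : measurable_fun setT (killed_mass n).
Proof.
apply: measurable_sum => u; apply: measurable_funM.
  by apply: measurableT_comp => //; exact: measurable_weight.
by apply: measurable_funB => //; exact: measurable_alive_.
Qed.

Lemma expect_killed_mass n : (\int[P]_t (killed_mass n t)%:E <=
  (\sum_(1 <= k < n.+1) kill_rate La eta del (k + K))%:E)%E.
Proof.
set S := \sum_(_ <= _ < _) _.
have mAa u : measurable_fun setT (fun t => (`|A t u| * (1 - al t u))%:E).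
  apply/measurable_EFinP; apply: measurable_funM.
    by apply: measurableT_comp => //; exact: measurable_weight.
  by apply: measurable_funB => //; exact: measurable_alive_.
rewrite /killed_mass; under eq_integral do rewrite -sumEFin.
rewrite ge0_integral_sum//; last first.
  by move=> u t _; rewrite lee_fin mulr_ge0// subr_ge0 alive_le1.
apply: (@le_trans _ _ (\sum_(u <- words n) (2 ^- n * S)%:E)%E).
  rewrite big_seq [leRHS]big_seq; apply: lee_sum => u.
  rewrite mem_words => /eqP un; have := expect_potential u; rewrite un.
  apply: le_trans; apply: ge0_le_integral => //.
  - by move=> t _; rewrite lee_fin mulr_ge0// subr_ge0 alive_le1.
  - by apply/measurable_EFinP; exact: measurable_potential.
  - move=> t _; rewrite lee_fin /potential ler_wpM2l// lerDl.
    by rewrite mulr_ge0 ?alive_ge0// divr_ge0// sqr_ge0.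
rewrite sumEFin lee_fin big_const_seq count_predT size_words iter_addr addr0.
by rewrite -[leLHS]mulr_natl natrX mulrA divff ?mul1r// gt_eqF// exprn_gt0.
Qed.

Lemma first_killed_ge0 n t : 0 <= first_killed n t.
Proof.
rewrite /first_killed big_seq; apply: sumr_ge0 => v; rewrite mem_words => /eqP vn.
rewrite mulr_ge0// subr_ge0.
case/lastP: v vn => [<-//|v b]; rewrite size_rcons => <- /=.
rewrite -cats1 take_size_cat// cats1 alive_rcons ler_piMr ?alive_ge0//.
rewrite /small_weight /low !indicE.
by case: (_ \in _); case: (_ \in _); rewrite ?mulr1 ?mulr0.
Qed.

Lemma measurable_first_killed n : measurable_fun setT (first_killed n).
Proof.
apply: measurable_sum => u; apply: measurable_funM.
  by apply: measurableT_comp => //; exact: measurable_weight.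
by apply: measurable_funB => //; exact: measurable_alive_.
Qed.

(** Children of dead words carry, in expectation, the mass of their parents; the remaining killed
    mass at level [n + 1] has a living parent. *)
Lemma expect_killed_massS n : (\int[P]_t (killed_mass n.+1 t)%:E =
  \int[P]_t (killed_mass n t)%:E + \int[P]_t (first_killed n.+1 t)%:E)%E.
Proof.
pose g b u t : R := `|A t (rcons u b)| * (1 - al t u).
have g0 b u t : 0 <= g b u t by rewrite mulr_ge0// subr_ge0 alive_le1.
have mg b u : measurable_fun setT (fun t => (g b u t)%:E).
  apply/measurable_EFinP; apply: measurable_funM.
    by apply: measurableT_comp => //; exact: measurable_weight.
  by apply: measurable_funB => //; exact: measurable_alive_.
have mf := measurable_first_killed n.+1.
have -> : (\int[P]_t (killed_mass n t)%:E =
    \int[P]_t \sum_(u <- words n) ((g false u t)%:E + (g true u t)%:E))%E.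
  rewrite /killed_mass; under eq_integral do rewrite -sumEFin.
  rewrite ge0_integral_sum//; last 2 first.
  - move=> u; apply/measurable_EFinP; apply: measurable_funM.
      by apply: measurableT_comp => //; exact: measurable_weight.
    by apply: measurable_funB => //; exact: measurable_alive_.
  - by move=> u t _; rewrite lee_fin mulr_ge0// subr_ge0 alive_le1.
  rewrite ge0_integral_sum//; last 2 first.
  - by move=> u; apply: emeasurable_funD; exact: mg.
  - by move=> u t _; rewrite adde_ge0// lee_fin g0.
  apply: eq_bigr => u _; rewrite ge0_integralD//; last 2 first.
  - by move=> t _; rewrite lee_fin g0.
  - by move=> t _; rewrite lee_fin g0.
  have h0 t : 0 <= 1 - al t u by rewrite subr_ge0 alive_le1.
  have mh : measurable_fun [set: past (short_words (size u))] (fun t => 1 - al t u).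
    by apply: measurable_funB => //; exact: (measurable_past_alive (@subset_refl _ _) (leqnn _)).
  rewrite !(expect_child_weight _ mh h0) -ge0_muleDl// -EFinD.
  by rewrite (_ : 1 / 2 + 1 / 2 = 1) ?mul1e//; lra.
rewrite -ge0_integralD//; last 4 first.
- by move=> t _; apply: sume_ge0 => u _; rewrite adde_ge0// lee_fin g0.
- by apply: emeasurable_sum => u; apply: emeasurable_funD; exact: mg.
- by move=> t _; rewrite lee_fin first_killed_ge0.
- exact/measurable_EFinP.
apply: eq_integral => t _.
have -> : (\sum_(u <- words n) ((g false u t)%:E + (g true u t)%:E) =
    (\sum_(u <- words n) (g false u t + g true u t))%:E)%E by rewrite -sumEFin.
rewrite -EFinD; congr (_%:E).
rewrite /killed_mass /first_killed !big_wordsS -big_split big_seq [RHS]big_seq /=.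
apply: eq_bigr => u; rewrite mem_words => /eqP un.
by rewrite -!cats1 -un !take_size_cat// !cats1 /g; ring.
Qed.

(** The losses telescope to the expected killed mass, so the bound on the latter already makes them
    summable. *)
Lemma sum_expect_first_killed n :
  (\sum_(1 <= k < n.+1) \int[P]_t (first_killed k t)%:E <=
   (\sum_(1 <= k < n.+1) kill_rate La eta del (k + K))%:E)%E.
Proof.
apply: (le_trans _ (expect_killed_mass n)).
suff -> : (\sum_(1 <= k < n.+1) \int[P]_t (first_killed k t)%:E =
  \int[P]_t (killed_mass n t)%:E)%E by [].
elim: n => [|n IH]; last by rewrite big_nat_recr//= IH expect_killed_massS.
rewrite big_geq// integral0_eq// => t _.
by rewrite /killed_mass /words big_seq1 /alive /= big_nil subrr mulr0.
Qed.

End cascade_expectation.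

(** * Exponential moments of the level increments *)

Section fluctuation.
Context {d : measure_display} {T : measurableType d} {R : realType}.
Variables (P : probability T R) (X : seq bool -> {RV P >-> R}).
Variables (La : probability (measurableTypeR R) R) (eta del : R) (K : nat).
Hypothesis X_indep : mutually_independent nonempty_words X.
Hypothesis X_law : forall u, u != [::] -> forall B : set R, measurable B ->
  P (X u @^-1` B) = La B.
Hypotheses (eta0 : 0 < eta) (eta1 : eta <= 1) (del0 : 0 < del).
Hypothesis La_mean : (\int[La]_y `|y|%:E = 1)%E.
Local Notation m := (clip_mean La eta del).
Hypothesis mE : forall k, m k <= ln 2 - 2 * del.

Let W t u := X u t.

Local Notation past J := (g_sigma_algebraType (cylinders X J)).

Definition pruned_weight t u : R :=
  cascade_weight (W t) u * alive eta del K m (W t) u.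

Definition pruned_mass n t : R := \sum_(u <- words n) pruned_weight t u.

(** Truncation uses [small_weight] but not [low]: the former depends on the weight at [v] alone, so
    the variables of one level stay independent with an explicit mean. *)
Definition centered_weight t v : R :=
  W t v * small_weight del (size v + K) (W t v) - (1 - large_mean La del (size v + K)).

Definition fluctuation n (c : seq bool -> R) t : R :=
  \sum_(v <- words n.+1) pruned_weight t (take n v) / 2 * centered_weight t v * c v.

Let mX_ v : measurable_fun setT (X v : T -> R). Proof. exact: measurable_funP. Qed.

Lemma measurable_pruned_weight u : measurable_fun setT (fun t => pruned_weight t u).
Proof.
by apply: measurable_funM; [exact: measurable_weight|exact: measurable_alive_].
Qed.

Lemma measurable_pruned_mass n : measurable_fun setT (pruned_mass n).
Proof. by apply: measurable_sum => u; exact: measurable_pruned_weight. Qed.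

Lemma measurable_centered_weight v : measurable_fun setT (fun t => centered_weight t v).
Proof.
apply: measurable_funB => //; apply: measurable_funM => //.
by apply: measurableT_comp => //; exact: measurable_small_weight.
Qed.

Lemma measurable_fluctuation n c : measurable_fun setT (fluctuation n c).
Proof.
apply: measurable_sum => v; apply: measurable_funM => //.
apply: measurable_funM; last exact: measurable_centered_weight.
by apply: measurable_funM => //; exact: measurable_pruned_weight.
Qed.

(* Given the first [n] levels the summands are independent and centered; the
   quadratic part of their cumulants is absorbed by [pruned_mass]. *)
Lemma exp_fluctuation_le1 n (c : seq bool -> R) (lam : R) : 0 <= lam ->
  (forall v, `|c v| <= 1) ->
  lam * (alive_bound del K n * expR (del / 2 * (n.+1 + K)%:R)) <= 1 ->
  lam ^+ 2 * (alive_bound del K n * expR (del / 2 * (n.+1 + K)%:R)) <= 1 ->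
  (\int[P]_t (expR (lam * fluctuation n c t - pruned_mass n t))%:E <= 1)%E.
Proof.
set k := (n.+1 + K)%N; set b := alive_bound _ _ _; set tau := expR _.
move=> lam0 c1 h1 h2.
have tau0 : 0 < tau by exact: expR_gt0.
pose x t v := lam * (pruned_weight t (take n v) / 2 * centered_weight t v * c v) -
  pruned_weight t (take n v) / 2.
have prune_bound t v : v \in words n.+1 -> 0 <= pruned_weight t (take n v) <= b.
  rewrite mem_words => /eqP vn.
  have := @alive_weight_bound R eta del K m eta0 eta1 del0 mE (W t) (take n v).
  by rewrite size_takel// vn.
(* Words of level [n + 1] are integrated out one at a time, each fresh with respect to the first [n]
   levels and to those left in [s]. The two terms [- pruned_weight / 2] of siblings add up to
   [- pruned_mass]. *)
suff H s : uniq s -> {subset s <= words n.+1} ->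
    (\int[P]_t (expR (\sum_(v <- s) x t v))%:E <= 1)%E.
  rewrite (_ : (fun t => _) = (fun t => (expR (\sum_(v <- words n.+1) x t v))%:E)).
    exact: H (words_uniq _) (fun _ => id).
  apply/funext => t; congr (expR _)%:E.
  rewrite /x big_split/= -mulr_sumr; congr (_ + _).
  rewrite sumrN big_wordsS/= /pruned_mass; congr (- _).
  rewrite big_seq [RHS]big_seq; apply: eq_bigr => u; rewrite mem_words => /eqP un.
  by rewrite -!cats1 -un !take_size_cat//; lra.
elim: s => [|v s IH] /=.
  move=> _ _; under eq_integral do rewrite big_nil expR0.
  by rewrite integral_cst// mul1e probability_le1.
move=> /andP[vs us] sub.
have vn : v \in words n.+1 by apply: sub; rewrite mem_head.
have sn : {subset s <= words n.+1} by move=> i si; apply: sub; rewrite inE si orbT.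
apply: le_trans (IH us sn).
pose J := short_words n `|` [set` s].
have sv : size v = n.+1 by apply/eqP; rewrite -mem_words.
have mpw i : size i = n.+1 -> measurable_fun [set: past J] (fun t => pruned_weight t (take n i)).
  move=> si; apply: measurable_funM.
    by apply: measurable_past_weight; [exact: subsetUl|rewrite size_takel// si].
  by apply: measurable_past_alive; [exact: subsetUl|rewrite size_takel// si].
have msx : measurable_fun [set: past J] (fun t => \sum_(i <- s) x t i).
  suff gen s0 : {subset s0 <= s} ->
      measurable_fun [set: past J] (fun t => \sum_(i <- s0) x t i) by exact: gen.
  elim: s0 => [|i s0 IHs0] si.
    by under eq_fun do rewrite big_nil; exact: measurable_cst.
  under eq_fun do rewrite big_cons.
  have {}si0 : i \in s by apply: si; rewrite mem_head.
  have i_n : size i = n.+1 by apply/eqP; rewrite -mem_words sn.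
  apply: measurable_funD; last first.
    by apply: IHs0 => j js; apply: si; rewrite inE js orbT.
  apply: measurable_funB; last by apply: measurable_funM => //; exact: mpw.
  apply: measurable_funM => //; apply: measurable_funM => //.
  apply: measurable_funM; first by apply: measurable_funM => //; exact: mpw.
  have mXi : measurable_fun [set: past J] (X i : _ -> R).
    by apply: measurable_coordinate; right.
  apply: measurable_funB => //; apply: measurable_funM => //.
  by apply: measurableT_comp => //; exact: measurable_small_weight.
pose a t := lam * (pruned_weight t (take n v) / 2 * c v).
pose f (z : past J * measurableTypeR R) : \bar R :=
  (expR (\sum_(i <- s) x z.1 i - pruned_weight z.1 (take n v) / 2 +
    a z.1 * (z.2 * small_weight del k z.2 - (1 - large_mean La del k))))%:E.
have f0 z : (0 <= f z)%E by rewrite lee_fin expR_ge0.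
have ma : measurable_fun [set: past J] a.
  by apply: measurable_funM => //; apply: measurable_funM => //; apply: measurable_funM => //; exact: mpw.
have mf : measurable_fun [set: past J * measurableTypeR R] f.
  apply/measurable_EFinP; apply: measurableT_comp => //; apply: measurable_funD.
    apply: measurable_funB; first exact: (measurableT_comp msx measurable_fst).
    by apply: measurable_funM => //; exact: (measurableT_comp (mpw _ sv) measurable_fst).
  apply: measurable_funM; first exact: (measurableT_comp ma measurable_fst).
  apply: measurable_funB => //; apply: measurable_funM => //.
  by apply: measurableT_comp => //; exact: measurable_small_weight.
have -> : (\int[P]_t (expR (\sum_(v <- v :: s) x t v))%:E = \int[P]_t f (t, X v t))%E.
  apply: eq_integral => t _; congr (expR _)%:E; rewrite big_cons /=.
  by rewrite {1}/x /a /centered_weight sv -/k /W; set S := \sum_(_ <- _) _; ring.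
have Jne : J `<=` nonempty_words.
  move=> i [/short_words_nonempty//|/= /sn].
  by rewrite mem_words /nonempty_words /= -size_eq0 => /eqP ->.
rewrite (integral_fresh_words X_indep X_law Jne _ _ mf f0); last 2 first.
- by rewrite -size_eq0 sv.
- by move=> [/andP[_]|/= ]; [rewrite sv ltnn|rewrite (negbTE vs)].
apply: ge0_le_integral => //.
- by move=> t _; apply: integral_ge0.
- apply: (@measurable_from_cylinders _ _ _ _ _ X _ _ J).
  exact: (measurable_fun_fubini_tonelli_F (m2 := La) f mf f0).
- apply/measurable_EFinP; apply: measurableT_comp => //.
  exact: (@measurable_from_cylinders _ _ _ _ _ X _ _ J).
move=> t _; rewrite /f /=.
under eq_integral do rewrite expRD EFinM.
have /andP[B0 Bb] := prune_bound t v vn.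
set B := pruned_weight _ _ in B0 Bb *.
rewrite ge0_integralZl_EFin ?expR_ge0//; last first.
  apply/measurable_EFinP; apply: measurableT_comp => //; apply: measurable_funM => //.
  apply: measurable_funB => //; apply: measurable_funM => //.
  exact: measurable_small_weight.
have anorm : `|a t| <= lam * B / 2.
  have B20 : 0 <= B / 2 by rewrite divr_ge0.
  rewrite /a -/B normrM (ger0_norm lam0) -[leRHS]mulrA ler_wpM2l//.
  by rewrite normrM (ger0_norm B20) ler_piMr.
have lBt : lam * (B * tau) <= 1.
  by rewrite (le_trans _ h1)// ler_wpM2l// ler_wpM2r// ltW.
have l2Bt : lam ^+ 2 * (B * tau) <= 1.
  by rewrite (le_trans _ h2)// ler_wpM2l ?sqr_ge0// ler_wpM2r// ltW.
have at2 : `|a t| * tau <= 1 / 2.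
  by apply: (le_trans (ler_wpM2r (ltW tau0) anorm)); lra.
have M := mgf_truncated_weight La_mean at2.
apply: (@le_trans _ _ ((expR (\sum_(i <- s) x t i - B / 2))%:E * (expR (2 * a t ^+ 2 * tau))%:E)%E).
  by apply: lee_wpmul2l => //; rewrite lee_fin expR_ge0.
rewrite -EFinM -expRD lee_fin ler_expR.
(* The first smallness condition made [mgf_truncated_weight] applicable; the second bounds its
   quadratic exponent by the [B / 2] subtracted in [x]. *)
suff : 2 * a t ^+ 2 * tau <= B / 2 by lra.
have : a t ^+ 2 <= (lam * B / 2) ^+ 2.
  have lB0 : 0 <= lam * B / 2 by apply: divr_ge0 => //; exact: mulr_ge0.
  by rewrite -real_normK ?num_real// lerXn2r ?nnegrE ?anorm.
move=> /(ler_wpM2r (ltW tau0)) h.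
have := ler_wpM2l B0 l2Bt; lra.
Qed.

End fluctuation.

(** * Oscillation on dyadic intervals *)

Section waves.
Context {R : realType}.
Implicit Types (xi th x : R) (u : seq bool).

Lemma dyadic_point_rcons u b :
  dyadic_point R (rcons u b) = dyadic_point R u + b%:R * 2 ^- (size u).+1.
Proof.
rewrite /dyadic_point.
rewrite -(big_mkord xpredT (fun j => (nth false (rcons u b) j)%:R * 2 ^- j.+1)).
rewrite -(big_mkord xpredT (fun j => (nth false u j)%:R * 2 ^- j.+1)).
rewrite size_rcons big_nat_recr//= nth_rcons ltnn eqxx; congr (_ + _).
by apply: eq_big_nat => i /andP[_ iu]; rewrite nth_rcons iu.
Qed.

Definition wave_primitive xi th x := sin (2 * pi * xi * x - th) / (2 * pi * xi).

(* Average over the dyadic interval of [u] of [cos (2 pi xi x - th)]. *)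
Definition wave xi th u : R := 2 ^+ size u *
  (wave_primitive xi th (dyadic_point R u + 2 ^- size u) -
   wave_primitive xi th (dyadic_point R u)).

Lemma is_derive_wave_primitive xi th x : xi != 0 ->
  is_derive x 1 (wave_primitive xi th) (cos (2 * pi * xi * x - th)).
Proof.
move=> xi0.
have p0 : 2 * pi * xi != 0 by rewrite !mulf_neq0// gt_eqF// pi_gt0.
have h : is_derive x 1 (fun y => 2 * pi * xi * y - th) (2 * pi * xi).
  by apply: is_derive_eq; rewrite subr0 /GRing.scale/= mulr1.
have -> : wave_primitive xi th =
    (2 * pi * xi)^-1 *: ((sin : R -> R) \o (fun y => 2 * pi * xi * y - th)).
  by apply/funext => y; rewrite /wave_primitive mulrC.
apply: is_derive_eq; rewrite /GRing.scale/=.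
by rewrite mulrCA mulVf ?mulr1.
Qed.

Lemma cos_lipschitz x y : `|cos x - cos y| <= `|x - y| :> R.
Proof.
wlog xy : x y / x <= y => [H|].
  have [/H//|/ltW/H] := leP x y; by rewrite distrC => h; rewrite (distrC x).
have D z : z \in `]x, y[%R -> is_derive z 1 (cos : R -> R) (- sin z).
  by move=> _; exact: is_derive_cos.
have C : {within `[x, y], continuous (cos : R -> R)}.
  by apply: continuous_subspaceT => z; exact: continuous_cos.
have [c _] := MVT_segment xy D C.
rewrite distrC => ->.
by rewrite normrM normrN (distrC x) ler_piMl// sin_max.
Qed.

Lemma continuous_wave_primitive xi th : xi != 0 -> continuous (wave_primitive xi th).
Proof.
move=> xi0 x; apply/differentiable_continuous/derivable1_diffP.
by have [] := is_derive_wave_primitive th x xi0.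
Qed.

(** By the mean value theorem the average is a value of the cosine. *)
Lemma wave_le1 xi th u : xi != 0 -> `|wave xi th u| <= 1.
Proof.
move=> xi0; rewrite /wave; set a := dyadic_point R u; set h := 2 ^- size u.
have h0 : 0 < h by rewrite invr_gt0 exprn_gt0.
have ah : a <= a + h by rewrite lerDl ltW.
have [|c _ ->] := MVT_segment ah (fun x _ => is_derive_wave_primitive th x xi0).
  by apply: continuous_subspaceT; exact: continuous_wave_primitive.
rewrite addrAC subrr add0r mulrCA /h divff ?mulr1 ?cos_max//.
Qed.

Lemma wave_decay xi th u : 0 < xi -> `|wave xi th u| <= 2 ^+ size u / (pi * xi).
Proof.
move=> xi0; have pi0 := @pi_gt0 R.
rewrite /wave normrM (ger0_norm (exprn_ge0 _ _))// ler_wpM2l ?exprn_ge0//.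
rewrite (le_trans (ler_normB _ _))//.
have b x : `|wave_primitive xi th x| <= (2 * pi * xi)^-1.
  have p0 : 0 < (2 * pi * xi)^-1 by rewrite invr_gt0 !mulr_gt0.
  by rewrite /wave_primitive normrM (gtr0_norm p0) ler_piMl ?sin_max// ltW.
apply: (le_trans (lerD (b _) (b _)));
move: pi pi0 => p p0 {b}; rewrite le_eqVlt; apply/orP; left; apply/eqP.
by field; rewrite !gt_eqF.
Qed.

(** The consistency between levels that [pruned_step] requires; the two halves share the
    midpoint. *)
Lemma wave_split xi th u :
  wave xi th u = (wave xi th (rcons u false) + wave xi th (rcons u true)) / 2.
Proof.
rewrite /wave !dyadic_point_rcons !size_rcons mul0r addr0 mul1r.
have -> : dyadic_point R u + 2 ^- (size u).+1 + 2 ^- (size u).+1 =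
    dyadic_point R u + 2 ^- size u.
  by rewrite exprS invfM; field; rewrite expf_neq0.
set p1 := wave_primitive _ _ (_ + 2 ^- (size u).+1); set p2 := wave_primitive _ _ _.
by set p3 := wave_primitive _ _ _; rewrite exprS; field.
Qed.

End waves.

(** * Summable bounds over a growing grid of frequencies *)

Lemma geometric_sum_le (R : realType) (r : R) n : 0 <= r -> r < 1 ->
  \sum_(0 <= k < n) r ^+ k <= (1 - r)^-1.
Proof.
move=> r0 r1; have r10 : 0 < 1 - r by rewrite subr_gt0.
have -> : \sum_(0 <= k < n) r ^+ k = (1 - r ^+ n) / (1 - r).
  elim: n => [|n IH]; first by rewrite big_geq// expr0 subrr mul0r.
  rewrite big_nat_recr//= IH exprS; field.
  by rewrite gt_eqF.
by rewrite ler_piMl ?invr_ge0 ?(ltW r10)// gerBl exprn_ge0.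
Qed.

Lemma sum_tail_small (R : realType) (f : nat -> R) (M e : R) :
  (forall k, 0 <= f k) -> (forall n, \sum_(0 <= k < n) f k <= M) -> 0 < e ->
  exists N0, forall N n, (N0 <= N)%N -> \sum_(N <= k < n) f k <= e.
Proof.
move=> f0 fM e0; pose S : set R := range (fun n => \sum_(0 <= k < n) f k).
have hS : has_sup S.
  split; first by exists 0; exists 0%N => //; rewrite big_geq.
  by exists M => _ [n _ <-].
have [_ [N0 _ <-] hN0] := sup_adherent e0 hS.
exists N0 => N n N0N.
have [nN|Nn] := leqP n N; first by rewrite big_geq// ltW.
have Sn : \sum_(0 <= k < n) f k <= sup S by apply: ub_le_sup; [case: hS|exists n].
have SN : \sum_(0 <= k < N0) f k <= \sum_(0 <= k < N) f k.
  by rewrite (big_cat_nat (n := N0) (p := N))//= lerDl sumr_ge0.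
have := Sn; rewrite (big_cat_nat (n := N) (p := n))//= 1?ltnW//.
lra.
Qed.

Lemma ae_bounded_series {d : measure_display} {T : measurableType d}
    {R : realType} (P : {measure set T -> \bar R}) (f : nat -> T -> R) (C : R) :
  (forall k, measurable_fun setT (f k)) -> (forall k t, 0 <= f k t) ->
  (forall n, \sum_(0 <= k < n) \int[P]_t (f k t)%:E <= C%:E)%E ->
  {ae P, forall t, exists M, forall n, \sum_(0 <= k < n) f k t <= M}.
Proof.
move=> mf f0 fC.
pose g t : \bar R := (\sum_(k <oo) (f k t)%:E)%E.
have mfE k : measurable_fun setT (fun t => (f k t)%:E) by exact/measurable_EFinP.
have f0E k t : (0 <= (f k t)%:E)%E by rewrite lee_fin.
have ig : P.-integrable setT g.
  apply/integrableP; split.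
    by apply: ge0_emeasurable_sum.
  under eq_integral do rewrite gee0_abs ?nneseries_ge0//.
  rewrite integral_nneseries//; apply: (@le_lt_trans _ _ C%:E); last exact: ltry.
  apply: lime_le; first by apply: is_cvg_nneseries => n _ _; exact: integral_ge0.
  by apply: nearW => n; exact: fC.
have := integrable_ae measurableT ig.
apply: (@filterS _ _ (ae_filter_ringOfSetsType P)) => t /(_ I) gt.
exists (fine (g t)) => n.
rewrite -lee_fin fineK// -sumEFin.
exact: nneseries_lim_ge.
Qed.

Section frequency_grid.
Context {d : measure_display} {T : measurableType d} {R : realType}.
Variables (P : probability T R) (X : seq bool -> {RV P >-> R}).
Variables (La : probability (measurableTypeR R) R) (eta del : R) (K : nat).
Hypothesis X_indep : mutually_independent nonempty_words X.
Hypothesis X_law : forall u, u != [::] -> forall B : set R, measurable B ->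
  P (X u @^-1` B) = La B.
Hypotheses (eta0 : 0 < eta) (eta1 : eta <= 1) (del0 : 0 < del).
Hypothesis La_mean : (\int[La]_y `|y|%:E = 1)%E.
Hypothesis mE : forall k, clip_mean La eta del k <= ln 2 - 2 * del.

(* The constant makes the first smallness condition of [exp_fluctuation_le1] an
   equality at [n = 0]. *)
Definition chernoff_rate n : R :=
  expR (del / 4 * n%:R - del * (3 * K%:R + 1) / 2).

(** The shift keeps the grid away from frequency [0], at which [wave_primitive] would divide by
    zero. *)
Definition frequency (q j : nat) : R := j.+1%:R / q%:R.

Definition chernoff_term q th n j t : R :=
  expR (chernoff_rate n *
    fluctuation X La eta del K n (wave (frequency q j) th) t -
    pruned_mass X La eta del K n t).

Lemma expect_chernoff_term q th n j : (0 < q)%N ->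
  (\int[P]_t (chernoff_term q th n j t)%:E <= 1)%E.
Proof.
move=> q0; apply: exp_fluctuation_le1 => //.
- exact: expR_ge0.
- by move=> v; apply: wave_le1; rewrite mulf_neq0// ?invr_eq0 pnatr_eq0// -lt0n.
- rewrite /chernoff_rate /alive_bound -!expRD -[leRHS]expR0 ler_expR natrD -(natr1 n).
  have := mulr_ge0 (ltW del0) (ler0n R n); lra.
- rewrite /chernoff_rate /alive_bound -expRM_natl -!expRD -[leRHS]expR0 ler_expR natrD -(natr1 n).
  have := del0; have := mulr_ge0 (ltW del0) (ler0n R K); lra.
Qed.

(** The [q * 4 ^ n] terms of level [n] have expectation at most [1]; dividing by [16 ^ n] leaves the
    convergent series of the [q / 4 ^ n]. *)
Lemma ae_chernoff_bound q th : (0 < q)%N ->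
  {ae P, forall t, exists M, forall n j, (j < q * 4 ^ n)%N ->
    chernoff_term q th n j t <= M * 16 ^+ n}.
Proof.
move=> q0.
pose Z n t := \sum_(0 <= j < q * 4 ^ n) chernoff_term q th n j t / 16 ^+ n.
have mt n j : measurable_fun setT (chernoff_term q th n j).
  apply: measurableT_comp => //; apply: measurable_funB.
    by apply: measurable_funM => //; exact: measurable_fluctuation.
  exact: measurable_pruned_mass.
have t0 n j t : 0 <= chernoff_term q th n j t / 16 ^+ n.
  by rewrite divr_ge0 ?expR_ge0// exprn_ge0.
have mZ n : measurable_fun setT (Z n).
  by apply: measurable_sum => j; exact: measurable_funM.
have EZ n : (\int[P]_t (Z n t)%:E <= (q%:R * 4^-1 ^+ n)%:E)%E.
  rewrite /Z; under eq_integral do rewrite -sumEFin.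
  rewrite ge0_integral_sum//; last 2 first.
  - by move=> j; apply/measurable_EFinP; exact: measurable_funM.
  - by move=> j t _; rewrite lee_fin.
  apply: (@le_trans _ _ (\sum_(0 <= j < q * 4 ^ n) ((16 : R) ^- n)%:E)%E).
    apply: lee_sum => j _; under eq_integral do rewrite mulrC EFinM.
    rewrite ge0_integralZl_EFin//; last 2 first.
    - by move=> t _; rewrite lee_fin expR_ge0.
    - exact/measurable_EFinP.
    rewrite -[leRHS]mule1; apply: lee_wpmul2l; first by rewrite lee_fin invr_ge0 exprn_ge0.
    exact: expect_chernoff_term.
  rewrite sumEFin lee_fin sumr_const_nat subn0 -[leLHS]mulr_natl natrM natrX.
  rewrite -mulrA ler_wpM2l// (_ : 16 = 4 * 4 :> R); last by lra.
  by rewrite exprMn invfM mulrA divff ?mul1r ?exprVn// expf_neq0.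
have Z0 n t : 0 <= Z n t by apply: sumr_ge0.
have ZC n : (\sum_(0 <= k < n) \int[P]_t (Z k t)%:E <= (q%:R * (1 - 4^-1)^-1)%:E)%E.
  apply: (@le_trans _ _ (\sum_(0 <= k < n) (q%:R * 4^-1 ^+ k)%:E)%E).
    by apply: lee_sum => k _; exact: EZ.
  rewrite sumEFin lee_fin -mulr_sumr ler_wpM2l// geometric_sum_le//; lra.
have := ae_bounded_series mZ Z0 ZC.
apply: (@filterS _ _ (ae_filter_ringOfSetsType P)) => t [M hM].
exists M => n j jq; rewrite -ler_pdivrMr ?exprn_gt0//.
apply: le_trans (hM n.+1); rewrite big_nat_recr//=.
have h : chernoff_term q th n j t / 16 ^+ n <= Z n t.
  rewrite /Z big_mkord (bigD1 (Ordinal jq))//= lerDl.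
  by apply: sumr_ge0.
by rewrite (le_trans h)// lerDr sumr_ge0.
Qed.

End frequency_grid.

(** * Fourier sums along a fixed realization *)

Section path.
Context {d : measure_display} {T : measurableType d} {R : realType}.
Variables (P : probability T R) (X : seq bool -> {RV P >-> R}).
Variables (La : probability (measurableTypeR R) R) (eta del : R) (K : nat).
Hypotheses (eta0 : 0 < eta) (eta1 : eta <= 1) (del0 : 0 < del).
Hypothesis La_mean : (\int[La]_y `|y|%:E = 1)%E.
Hypothesis mE : forall k, clip_mean La eta del k <= ln 2 - 2 * del.
Variable t : T.

Local Notation m := (clip_mean La eta del).
Local Notation W := (fun u => X u t).
Local Notation A u := (cascade_weight W u).
Local Notation al u := (alive eta del K m W u).
Local Notation pw u := (pruned_weight X La eta del K t u).
Local Notation mass n := (pruned_mass X La eta del K n t).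

Lemma pruned_weight_ge0 u : 0 <= pw u.
Proof. by have /andP[] := @alive_weight_bound R eta del K m eta0 eta1 del0 mE W u. Qed.

(** Truncation lowers the mean by [large_mean], and killing removes mass; since [c] has absolute
    value at most [1], each error is bounded from above whatever its sign. *)
Lemma pruned_child_le u b (c : R) : `|c| <= 1 ->
  pw (rcons u b) * c <=
  pw u / 2 * centered_weight X La del K t (rcons u b) * c + pw u / 2 * c +
  large_mean La del ((size u).+1 + K) * pw u / 2 +
  `|A (rcons u b)| * (al u - al (rcons u b)).
Proof.
move=> c1; have pw0 := pruned_weight_ge0 u.
rewrite /centered_weight size_rcons /pruned_weight cascade_weight_rcons alive_rcons.
rewrite /pruned_weight in pw0.
set k := ((size u).+1 + K)%N; set w := X (rcons u b) t.
set p := large_mean La del k; set l := low _ _ _; set a := alive _ _ _ _ _ _ in pw0 *.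
set s := small_weight _ _ _; set Au := cascade_weight _ _ in pw0 *.
have p0 : 0 <= p by exact: large_mean_ge0.
have a0 : 0 <= a by exact: alive_ge0.
have s01 : s = 0 \/ s = 1 by exact: small_weight01.
have l01 : l = 0 \/ l = 1 by rewrite /l /low indicE; case: (_ \in _); [right|left].
have /andP[cl cu] : -1 <= c <= 1 by rewrite -ler_norml.
have h1 : 0 <= p * (Au * a) * (1 + c) by apply: mulr_ge0; [exact: mulr_ge0|lra].
suff h2 : - (Au / 2 * w * a * s * (1 - l) * c) <= `|Au / 2 * w| * (a - a * (s * l)) by lra.
set x := Au / 2 * w; have xa0 := mulr_ge0 (normr_ge0 x) a0.
have key : - (x * a * c) <= `|x| * a.
  rewrite (le_trans (ler_norm _))// normrN normrM (normrM x) (ger0_norm a0).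
  by rewrite ler_piMr.
by case: s01 => ->; case: l01 => ->; lra.
Qed.

Lemma pruned_step n (c : seq bool -> R) :
  (forall u, `|c u| <= 1) ->
  (forall u, c u = (c (rcons u false) + c (rcons u true)) / 2) ->
  \sum_(u <- words n.+1) pw u * c u <=
  \sum_(u <- words n) pw u * c u + fluctuation X La eta del K n c t +
  large_mean La del (n.+1 + K) * mass n + first_killed X La eta del K n.+1 t.
Proof.
move=> c1 cE.
rewrite /fluctuation /first_killed /pruned_mass !big_wordsS/= mulr_sumr -!big_split/=.
rewrite big_seq [leRHS]big_seq; apply: ler_sum => u; rewrite mem_words => /eqP un.
rewrite -!cats1 -un !take_size_cat// !cats1.
have hf := pruned_child_le u false (c1 (rcons u false)).
have ht := pruned_child_le u true (c1 (rcons u true)).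
apply: le_trans (lerD hf ht) _; rewrite le_eqVlt; apply/orP; left; apply/eqP.
rewrite (cE u).
move: (pw u) (large_mean _ _ _) (c (rcons u true)) (c (rcons u false)) => a p ct cf.
move: (`|A (rcons u false)|) (`|A (rcons u true)|) (al u) (al (rcons u false))
  (al (rcons u true)) => Af At l lf lt_.
move: (centered_weight X La del K t (rcons u false))
  (centered_weight X La del K t (rcons u true)) => zf zt.
by field.
Qed.

Lemma pruned_telescope N n (c : seq bool -> R) (e : nat -> R) :
  (forall u, `|c u| <= 1) ->
  (forall u, c u = (c (rcons u false) + c (rcons u true)) / 2) ->
  (forall k, (N <= k < n)%N -> fluctuation X La eta del K k c t +
    large_mean La del (k.+1 + K) * mass k + first_killed X La eta del K k.+1 t <= e k) ->
  (N <= n)%N ->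
  \sum_(u <- words n) pw u * c u <=
  \sum_(u <- words N) pw u * c u + \sum_(N <= k < n) e k.
Proof.
move=> c1 cE; elim: n => [|n IH] he.
  by rewrite leqn0 => /eqP ->; rewrite big_geq// addr0.
rewrite leq_eqVlt => /predU1P[<-|]; first by rewrite big_geq// addr0.
rewrite ltnS => Nn; rewrite big_nat_recr//=.
have := pruned_step n c1 cE; have := he n; rewrite Nn ltnSn => /(_ isT).
have : \sum_(u <- words n) pw u * c u <=
    \sum_(u <- words N) pw u * c u + \sum_(N <= k < n) e k.
  by apply: IH => // k /andP[Nk kn]; apply: he; rewrite Nk ltnW.
lra.
Qed.

Hypothesis A_ge0 : forall u, 0 <= A u.
Variable Y : R.
Hypothesis A_sum : forall n, \sum_(u <- words n) A u <= Y.

Lemma pruned_mass_ge0 n : 0 <= mass n.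
Proof. by apply: sumr_ge0 => u _; exact: pruned_weight_ge0. Qed.

Lemma pruned_mass_le n : mass n <= Y.
Proof.
apply: (le_trans _ (A_sum n)); apply: ler_sum => u _.
by rewrite /pruned_weight ler_piMr// alive_le1.
Qed.

(** Take logarithms and divide by [chernoff_rate], which is of order [expR (del / 4 * k)]. Half of
    this exponent absorbs the factor linear in [k]. *)
Lemma fluctuation_le q th k j (M : R) : (0 < q)%N ->
  chernoff_term X La eta del K q th k j t <= M * 16 ^+ k ->
  fluctuation X La eta del K k (wave (frequency q j) th) t <=
  (Y + `|M| + 120 / del) * expR (del * (3 * K%:R + 1) / 2) * expR (- (del / 8)) ^+ k.
Proof.
move=> q0 hM.
have Y0 : 0 <= Y := le_trans (pruned_mass_ge0 0) (pruned_mass_le 0).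
have M0 : 0 <= M.
  by have := le_trans (expR_ge0 _) hM; rewrite pmulr_lge0 ?exprn_gt0.
have h : chernoff_rate del K k *
    fluctuation X La eta del K k (wave (frequency q j) th) t <= Y + `|M| + 15 * k%:R.
  (* The [15] comes from [16 <= expR 15], an instance of [1 + x <= expR x]. *)
  have : chernoff_term X La eta del K q th k j t <= expR (`|M| + 15 * k%:R).
    apply: (le_trans hM); rewrite expRD [15 * _]mulrC expRM_natl ler_pM ?exprn_ge0//.
    by rewrite (le_trans (ler_norm _))// (le_trans _ (expR_ge1Dx _))// lerDr.
    rewrite lerXn2r ?nnegrE ?expR_ge0//.
    by apply: le_trans (expR_ge1Dx _); lra.
  rewrite ler_expR => h; have := pruned_mass_le k; lra.
set fl := fluctuation _ _ _ _ _ _ _ _ in h *.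
have lam0 : 0 < chernoff_rate del K k by exact: expR_gt0.
rewrite mulrC -ler_pdivlMr// in h; apply: (le_trans h).
have -> : (chernoff_rate del K k)^-1 =
    expR (del * (3 * K%:R + 1) / 2) * expR (- (del / 4 * k%:R)).
  by rewrite /chernoff_rate -expRN -expRD; congr expR; ring.
have -> : expR (- (del / 8)) ^+ k = expR (- (del / 4 * k%:R)) * expR (del / 8 * k%:R).
  by rewrite -expRM_natl -expRD; congr expR; field.
rewrite mulrCA -[leRHS]mulrA [leRHS]mulrCA ler_wpM2l ?expR_ge0//.
rewrite [leRHS]mulrCA mulrC ler_wpM2l ?expR_ge0//.
(* Here [120 / del] is [15 * (8 / del)], from [x <= expR x] at [x = del / 8 * k]. *)
have k1 : 15 * k%:R <= 120 / del * expR (del / 8 * k%:R).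
  rewrite mulrAC ler_pdivlMr//.
  have := expR_ge1Dx (del / 8 * k%:R); lra.
have k2 : Y + `|M| <= (Y + `|M|) * expR (del / 8 * k%:R).
  rewrite ler_peMr ?addr_ge0//.
  apply: le_trans (expR_ge1Dx _); rewrite lerDl mulr_ge0// divr_ge0// ltW//.
lra.
Qed.

(* With [N] the least level such that [j < q * 4 ^ N], waves at level [N.-1] are
   small because they oscillate, and the later increments form the tail of a
   convergent series. *)
Lemma mean_wave_small q th (M1 M2 M3 eps : R) : (0 < q)%N -> 0 < eps ->
  (forall n, \sum_(0 <= k < n) first_killed X La eta del K k.+1 t <= M1) ->
  (forall n j, (j < q * 4 ^ n)%N ->
     chernoff_term X La eta del K q th n j t <= M2 * 16 ^+ n) ->
  (forall n, \sum_(0 <= k < n) large_mean La del (k.+1 + K) <= M3) ->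
  (forall N, exists n, (N <= n)%N /\ killed_mass X La eta del K n t <= eps) ->
  exists J, forall j, (J <= j)%N -> forall N, exists n, (N <= n)%N /\
    \sum_(u <- words n) A u * wave (frequency q j) th u <= 3 * eps.
Proof.
move=> q0 eps0 HF HG Hp HL.
have Y0 : 0 <= Y := le_trans (pruned_mass_ge0 0) (pruned_mass_le 0).
set D := (Y + `|M2| + 120 / del) * expR (del * (3 * K%:R + 1) / 2).
have D0 : 0 <= D by rewrite mulr_ge0 ?expR_ge0// !addr_ge0// divr_ge0// ltW.
set r := expR (- (del / 8)).
have r0 : 0 <= r by exact: expR_ge0.
have r1 : r < 1 by rewrite /r -[ltRHS]expR0 ltr_expR oppr_lt0 divr_gt0.
pose e k := D * r ^+ k + Y * large_mean La del (k.+1 + K) +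
  first_killed X La eta del K k.+1 t.
have e0 k : 0 <= e k.
  by rewrite !addr_ge0 ?first_killed_ge0// mulr_ge0 ?exprn_ge0 ?large_mean_ge0.
have eM n : \sum_(0 <= k < n) e k <= D * (1 - r)^-1 + Y * M3 + M1.
  rewrite /e !big_split/= -!mulr_sumr.
  by rewrite !lerD// ler_wpM2l// geometric_sum_le.
have [N0 HN0] := sum_tail_small e0 eM eps0.
(* From [N1] on, the oscillation bound [2 * Y / 2 ^ N] of [h3] is below [eps]. *)
pose N1 := (Num.truncn (4 * Y / eps)).+1.
have N1P : 4 * Y <= eps * N1%:R.
  by rewrite [leRHS]mulrC -ler_pdivrMr//; exact/ltW/truncnS_gt.
exists (q * 4 ^ (maxn N0 N1))%N => j Jj N2.
have ex : exists N, (j < q * 4 ^ N)%N.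
  by exists j; rewrite (leq_trans (ltn_expl j (isT : 1 < 4)%N))// leq_pmull.
(* Now [N.+1] is the least level whose grid contains [j], and the telescoping starts there;
   minimality gives the lower bound on the frequency. Level [0] is excluded by the choice of the
   witness below [j]. *)
case: (ex_minnP ex) => -[|N] jN minN.
  have := leq_ltn_trans Jj jN; rewrite ltn_pmul2l// ltn_exp2l// ltn0//.
have {minN} Nj : (q * 4 ^ N <= j)%N.
  by rewrite leqNgt; apply/negP => /minN; rewrite ltnn.
have mN : (maxn N0 N1 <= N)%N.
  by have := leq_ltn_trans Jj jN; rewrite ltn_pmul2l// ltn_exp2l.
have [n [nN HLn]] := HL (maxn N.+1 N2).
exists n; split; first by rewrite (leq_trans (leq_maxr N.+1 N2)).
have nN1 : (N.+1 <= n)%N by rewrite (leq_trans (leq_maxl N.+1 N2)).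
set xi := frequency q j.
have xi0 : 0 < xi by rewrite divr_gt0 ?ltr0n.
have c1 u : `|wave xi th u| <= 1 by apply: wave_le1; rewrite gt_eqF.
have h1 : \sum_(u <- words n) pw u * wave xi th u <=
    \sum_(u <- words N.+1) pw u * wave xi th u + \sum_(N.+1 <= k < n) e k.
  apply: pruned_telescope => //; first exact: wave_split.
  move=> k /andP[Nk kn]; rewrite /e !lerD//.
    apply: fluctuation_le => //; apply: HG.
    by rewrite (leq_trans jN)// leq_pmul2l// leq_exp2l.
  by rewrite mulrC ler_wpM2r ?large_mean_ge0// pruned_mass_le.
have h2 : \sum_(N.+1 <= k < n) e k <= eps.
  by apply: HN0; rewrite (leq_trans _ (leqnSn N))// (leq_trans _ mN)// leq_maxl.
have h3 : \sum_(u <- words N.+1) pw u * wave xi th u <= eps.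
  apply: (@le_trans _ _ (\sum_(u <- words N.+1) pw u * (2 ^+ N.+1 / (pi * xi)))).
    rewrite big_seq [leRHS]big_seq; apply: ler_sum => u; rewrite mem_words => /eqP un.
    rewrite ler_wpM2l ?pruned_weight_ge0// (le_trans (ler_norm _))//.
    by rewrite -un; exact: wave_decay.
  rewrite -mulr_suml -/(pruned_mass X La eta del K N.+1 t).
  have xi4 : 4 ^+ N <= xi.
    rewrite /xi /frequency ler_pdivlMr ?ltr0n// mulrC -natrX -natrM ler_nat.
    exact: leq_trans Nj (leqnSn _).
  have pi1 : 1 <= pi :> R by have := @pi_ge2 R; lra.
  have pix : 4 ^+ N <= pi * xi by rewrite (le_trans xi4)// ler_peMl// ltW.
  apply: (@le_trans _ _ (Y * (2 ^+ N.+1 / 4 ^+ N))).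
    apply: ler_pM; rewrite ?pruned_mass_ge0 ?pruned_mass_le//.
      by rewrite divr_ge0 ?exprn_ge0// mulr_ge0 ?ltW// (lt_le_trans _ pi1).
    rewrite ler_wpM2l ?exprn_ge0// lef_pV2 ?posrE ?exprn_gt0// mulr_gt0//.
    by rewrite (lt_le_trans _ pi1).
  have -> : 2 ^+ N.+1 / 4 ^+ N = 2 / 2 ^+ N :> R.
    rewrite (_ : 4 = 2 * 2 :> R); last by lra.
    by rewrite exprMn exprS invfM; field; rewrite expf_neq0.
  rewrite mulrA ler_pdivrMr ?exprn_gt0//.
  have : eps * N1%:R <= eps * 2 ^+ N.
    rewrite ler_wpM2l ?(ltW eps0)// -natrX ler_nat.
    rewrite (leq_trans _ (ltnW (ltn_expl N (isT : 1 < 2)%N)))//.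
    by rewrite (leq_trans _ mN)// leq_maxr.
  by lra.
(* The third [eps]: restoring the killed words costs at most their mass, which is small at the
   chosen [n]. *)
have h4 : \sum_(u <- words n) A u * wave xi th u <=
    \sum_(u <- words n) pw u * wave xi th u + killed_mass X La eta del K n t.
  rewrite /killed_mass -big_split/=; apply: ler_sum => u _.
  rewrite /pruned_weight ger0_norm//.
  have Aal0 : 0 <= A u * (1 - al u) by rewrite mulr_ge0 ?A_ge0// subr_ge0 alive_le1.
  have wv1 : wave xi th u <= 1 := le_trans (ler_norm _) (c1 u).
  have := ler_wpM2l Aal0 wv1; lra.
lra.
Qed.

End path.

Import HBNNSimple.

(** * Weak limits of the approximating measures *)

(** [cascade_approx] is a bare set function, so its integrals are first moved to a genuine measure.
    Integrals of simple functions see only the values on measurable sets. *)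
Lemma eq_set_function_integral {d : measure_display} {T : measurableType d}
    {R : realType} (nu nu' : set T -> \bar R) (f : T -> \bar R) :
  (forall B, measurable B -> nu B = nu' B) ->
  (\int[nu]_x f x = \int[nu']_x f x)%E.
Proof.
move=> nuE.
have E (h : {nnsfun T >-> R}) : sintegral nu h = sintegral nu' h.
  by apply: eq_fsbigr => r _; rewrite nuE.
rewrite /integral; congr (ereal_sup _ - ereal_sup _)%E;
  by apply/seteqP; split=> _ [h hf <-]; exists h => //; rewrite E.
Qed.

Section cascade_integral.
Context {R : realType}.
Variables (w : seq bool -> R).
Local Notation A u := (cascade_weight w u).
Hypothesis A_ge0 : forall u, 0 <= A u.
Local Notation leb := (@lebesgue_measure R).

Let len_lt (u : seq bool) :
  dyadic_point R u < dyadic_point R u + 2 ^- size u.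
Proof. by rewrite ltrDl invr_gt0 exprn_gt0. Qed.

Lemma dyadic_point_all1 u : all id u -> dyadic_point R u + 2 ^- size u = 1.
Proof.
elim/last_ind: u => [_|u b IH].
  by rewrite /dyadic_point /= big_ord0 add0r expr0 invr1.
rewrite all_rcons => /andP[/= -> /IH E].
rewrite dyadic_point_rcons size_rcons mul1r -addrA -[RHS]E; congr (_ + _).
by rewrite exprS; field; rewrite expf_neq0.
Qed.

Lemma dyadic_point_bounds u :
  0 <= dyadic_point R u /\ dyadic_point R u + 2 ^- size u <= 1.
Proof.
elim/last_ind: u => [|u b [a0 a1]].
  by rewrite /dyadic_point /= big_ord0 add0r expr0 invr1.
rewrite dyadic_point_rcons size_rcons.
have h : 2 ^- size u = 2 ^- (size u).+1 + 2 ^- (size u).+1 :> R.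
  by rewrite exprS; field; rewrite expf_neq0.
have h0 : 0 <= 2 ^- (size u).+1 :> R by rewrite invr_ge0 exprn_ge0.
by move: a1; rewrite h; case: b; rewrite ?mul1r ?mul0r; split; lra.
Qed.

Let dyadic_interval_measurable u : measurable (@dyadic_interval R u).
Proof. by rewrite /dyadic_interval; case: ifP. Qed.

(** The uniform density lives on the closed interval; the two densities can differ only at its right
    endpoint, a null set. *)
Let uniform_dyadic u (B : set (measurableTypeR R)) : measurable B ->
  (\int[leb]_(x in B) (2 ^+ size u * \1_(@dyadic_interval R u) x)%:E =
   uniform_prob (len_lt u) B)%E.
Proof.
move=> mB; apply: ge0_ae_eq_integral => //.
- apply/measurable_EFinP; apply: measurable_funTS; apply: measurable_funM => //.
  by apply: measurable_indic; exact: dyadic_interval_measurable.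
- by apply/measurable_EFinP; apply: measurable_funTS; exact: measurable_uniform_pdf.
- by move=> x _; rewrite lee_fin uniform_pdf_ge0.
exists [set dyadic_point R u + 2 ^- size u]; split => //.
  exact: lebesgue_measure_set1.
move=> x /= /not_implyP[_]; apply: contra_notP => xb.
rewrite /uniform_pdf addrAC subrr add0r invrK indicE /dyadic_interval.
case: ifP => [/dyadic_point_all1 E|_].
  rewrite -[X in `[_, X]]E; case: (boolP (_ <= _ <= _)) => h.
    by rewrite mem_set ?mulr1//= in_itv.
  by rewrite memNset ?mulr0//= in_itv/=; exact/negP.
have xE : (x <= dyadic_point R u + 2 ^- size u) = (x < dyadic_point R u + 2 ^- size u).
  by rewrite le_eqVlt (negbTE (_ : x != _))//; apply/eqP.
case: (boolP (_ <= _ <= _)) => h.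
  by rewrite mem_set ?mulr1//= in_itv/= -xE.
by rewrite memNset ?mulr0//= in_itv/= -xE; exact/negP.
Qed.

Let component (v : nat -> seq bool) (k : nat) : {measure set (measurableTypeR R) -> \bar R} :=
  mscale (NngNum (A_ge0 (v k))) (uniform_prob (len_lt (v k))).

Let sum_words (V : nmodType) n (F : seq bool -> V) :
  \sum_(u <- words n) F u = \sum_(k < size (words n)) F (nth [::] (words n) k).
Proof. by rewrite (big_nth [::]) big_mkord. Qed.

(** The approximating measure is a finite combination, with coefficients [A u], of uniform laws on
    the dyadic intervals. *)
Lemma integral_cascade_approx n (f : R -> R) : measurable_fun setT f ->
  (forall x, 0 <= f x) ->
  (\int[cascade_approx w n]_x (f x)%:E =
   \sum_(u <- words n) (A u)%:E * ((2 ^+ size u)%:E *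
     \int[leb]_(x in `[dyadic_point R u, (dyadic_point R u + 2 ^- size u)%R]) (f x)%:E))%E.
Proof.
move=> mf f0.
pose v k := nth [::] (words n) k.
rewrite (@eq_set_function_integral _ _ _ _ (msum (component v) (size (words n)))).
  rewrite ge0_integral_measure_sum//; last 2 first.
  - by move=> x _; rewrite lee_fin.
  - exact/measurable_EFinP.
  rewrite sum_words; apply: eq_bigr => k _.
  rewrite ge0_integral_mscale//; last 2 first.
  - exact/measurable_EFinP.
  - by move=> x _; rewrite lee_fin.
  rewrite integral_uniform//; last exact/measurable_EFinP.
  by rewrite addrAC subrr add0r invrK.
move=> B mB; rewrite /cascade_approx /msum /cascade_density.
under eq_integral do rewrite (sum_tuple_words n (fun u =>
  2 ^+ n * A u * \1_(@dyadic_interval R u) _)) -sumEFin.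
rewrite ge0_integral_sum//; last 2 first.
- move=> u; apply/measurable_EFinP; apply: measurable_funTS.
  by apply: measurable_funM => //; apply: measurable_indic; exact: dyadic_interval_measurable.
- by move=> u x _; rewrite lee_fin; apply: mulr_ge0 => //; apply: mulr_ge0 => //; exact: exprn_ge0.
rewrite -(sum_words n (fun u => mscale (NngNum (A_ge0 u)) (uniform_prob (len_lt u)) B)).
rewrite big_seq [RHS]big_seq; apply: eq_bigr => u; rewrite mem_words => /eqP un.
transitivity ((A u)%:E *
    \int[leb]_(x in B) (2 ^+ size u * \1_(@dyadic_interval R u) x)%:E)%E; last first.
  by rewrite uniform_dyadic.
rewrite -ge0_integralZl_EFin//; last first.
  apply/measurable_EFinP; apply: measurable_funTS; apply: measurable_funM => //.
  by apply: measurable_indic; exact: dyadic_interval_measurable.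
by apply: eq_integral => x _; rewrite -EFinM un /=; congr (_%:E); ring.
Qed.

Let integral_affine_interval (a b c : R) : a < b ->
  (\int[leb]_(x in `[a, b]) c%:E = (c * (b - a))%:E)%E.
Proof.
move=> ab; rewrite integral_cst//= lebesgue_measure_itv/= lte_fin ab.
by rewrite -EFinD -EFinM.
Qed.

Lemma integral_cascade_approx_cst n (c : R) : 0 <= c ->
  (\int[cascade_approx w n]_x c%:E = (c * \sum_(u <- words n) A u)%:E)%E.
Proof.
move=> c0; rewrite (@integral_cascade_approx n (fun=> c))//.
rewrite mulr_sumr -sumEFin; apply: eq_bigr => u _.
rewrite integral_affine_interval// -!EFinM; congr (_%:E).
by rewrite addrAC subrr add0r (mulrCA (2 ^+ size u)) divff ?expf_neq0// mulr1 mulrC.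
Qed.

(** The added [1] makes the integrand nonnegative, as [integral_cascade_approx] requires;
    [cvg_cosine_transform] subtracts the total mass again. *)
Lemma integral_cascade_approx_wave n (xi th : R) : xi != 0 ->
  (\int[cascade_approx w n]_x (1 + cos (2 * pi * xi * x - th))%:E =
   (\sum_(u <- words n) A u * (1 + wave xi th u))%:E)%E.
Proof.
move=> xi0.
have c_cont : continuous (fun x : R => 1 + cos (2 * pi * xi * x - th)).
  move=> x; apply: cvgD; first exact: cvg_cst.
  apply: (@continuous_comp _ _ _ (fun x : R => 2 * pi * xi * x - th) cos);
  last exact: continuous_cos.
  by apply: cvgB; [exact: mulrl_continuous|exact: cvg_cst].
rewrite (integral_cascade_approx n (f := fun x => 1 + cos (2 * pi * xi * x - th))); last 2 first.
- exact: continuous_measurable_fun.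
- by move=> x; have := cos_geN1 (2 * pi * xi * x - th); lra.
rewrite -sumEFin; apply: eq_bigr => u _.
have D (x : R) : is_derive x 1 (fun x : R => x + wave_primitive xi th x)
    (1 + cos (2 * pi * xi * x - th)).
  by apply: is_deriveD; exact: is_derive_wave_primitive.
have cF : continuous (fun x : R => x + wave_primitive xi th x).
  by move=> x; apply/differentiable_continuous/derivable1_diffP; have [] := D x.
rewrite (@continuous_FTC2 _ _ (fun x => x + wave_primitive xi th x))//.
- rewrite -EFinD -!EFinM; congr (_%:E); congr (_ * _).
  rewrite /wave opprD addrACA (addrAC (dyadic_point R u)) subrr add0r mulrDr.
  by rewrite divff// expf_neq0.
- exact: continuous_subspaceT.
- split.
  + by move=> x _; have [] := D x.
  + exact/cvg_at_right_filter/cF.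
  + exact/cvg_at_left_filter/cF.
- by move=> x _; rewrite derive1E; have [] := D x.
Qed.

Lemma integral_cascade_approx_le n (f : R -> R) (c : R) : measurable_fun setT f ->
  (forall x, 0 <= f x) -> (forall x, 0 <= x <= 1 -> f x <= c) ->
  (\int[cascade_approx w n]_x (f x)%:E <= (c * \sum_(u <- words n) A u)%:E)%E.
Proof.
move=> mf f0 fc; rewrite integral_cascade_approx//.
rewrite mulr_sumr -sumEFin; apply: lee_sum => u _.
have -> : ((c * A u)%:E = (A u)%:E * c%:E)%E by rewrite -EFinM mulrC.
apply: lee_wpmul2l; first by rewrite lee_fin.
apply: (@le_trans _ _ ((2 ^+ size u)%:E * (c * 2 ^- size u)%:E)%E); last first.
  by rewrite -EFinM lee_fin mulrCA divff ?mulr1// expf_neq0.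
apply: lee_wpmul2l; first by rewrite lee_fin exprn_ge0.
have E := integral_affine_interval c (len_lt u); rewrite addrAC subrr add0r in E.
rewrite -E; apply: ge0_le_integral => //.
- by move=> x _; rewrite lee_fin.
- by apply/measurable_EFinP; exact: measurable_funTS.
- move=> x; rewrite /= in_itv/= => /andP[x0 x1]; rewrite lee_fin fc//.
  have [a0 a1] := dyadic_point_bounds u.
  by rewrite (le_trans a0 x0) (le_trans x1 a1).
Qed.

End cascade_integral.

(** * The law of the weight *)

Section log_estimates.
Context {R : realType}.
Implicit Types y eta : R.

Lemma ln_le_sub1 y : 0 < y -> ln y <= y - 1.
Proof.
move=> y0; have := @le_ln1Dx R (y - 1).
by rewrite (_ : 1 + (y - 1) = y); [apply; lra|ring].
Qed.

(** For [0 < y < eta] the inequality [ln x <= x - 1] at [x = eta / y] bounds the cost of the floor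
    by [eta]. *)
Lemma ylnmax_le y eta : 0 < eta -> eta <= 1 ->
  `|y| * ln (Num.max y eta) <= y * ln y + eta.
Proof.
move=> eta0 eta1; have lneta : ln eta <= 0 by rewrite ln_le0.
have [y0|y0] := leP y 0.
  rewrite (ln0 y0) mulr0 add0r (_ : Num.max y eta = eta); last first.
    by apply/max_idPr; rewrite (le_trans y0)// ltW.
  by rewrite (le_trans _ (ltW eta0))// mulr_ge0_le0.
rewrite gtr0_norm//; have [ye|ye] := leP eta y.
  by rewrite lerDl ltW.
have h : ln eta - ln y <= eta / y - 1.
  by rewrite -ln_div ?posrE// ln_le_sub1// divr_gt0.
have := ler_wpM2l (ltW y0) h; rewrite mulrBr mulrBr mulrCA divff ?gt_eqF// !mulr1.
lra.
Qed.

(** Between [0] and [1] the function is bounded by [1], so the moment of the positive part of the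
    logarithm controls everything. *)
Lemma norm_yln_le y : `|y * ln y| <= y * Num.max (ln y) 0 + 1.
Proof.
have [y0|y0] := leP y 0; first by rewrite (ln0 y0) mulr0 normr0 maxxx mulr0 add0r.
have [y1|y1] := leP 1 y.
  have l0 : 0 <= ln y by rewrite ln_ge0.
  have yl0 : 0 <= y * ln y by rewrite mulr_ge0// ltW.
  by rewrite (max_idPl l0) (ger0_norm yl0) lerDl.
have l0 : ln y <= 0 by rewrite ln_le0// ltW.
have yl0 : y * ln y <= 0 by rewrite mulr_ge0_le0// ltW.
rewrite (max_idPr l0) mulr0 add0r (ler0_norm yl0).
have h : - ln y <= y^-1 - 1 by rewrite -lnV ?posrE// ln_le_sub1// invr_gt0.
have := ler_wpM2l (ltW y0) h; rewrite mulrBr mulfV ?gt_eqF// mulr1; lra.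
Qed.

Lemma norm_ylnmax_le y eta : 0 < eta -> eta <= 1 ->
  `|y| * `|ln (Num.max y eta)| <= y * Num.max (ln y) 0 + `|ln eta| * `|y|.
Proof.
move=> eta0 eta1; have lneta : ln eta <= 0 by rewrite ln_le0.
have p0 : 0 <= y * Num.max (ln y) 0.
  have [y0|y0] := leP y 0; first by rewrite (ln0 y0) maxxx mulr0.
  by rewrite mulr_ge0 ?(ltW y0)// le_max lexx orbT.
have [ye|ye] := leP y eta.
  by rewrite mulrC lerDr.
have y0 : 0 < y := lt_trans eta0 ye.
rewrite (gtr0_norm y0) [X in _ + X]mulrC -mulrDr ler_pM2l//.
have [l0|l0] := leP 0 (ln y); first by rewrite ger0_norm// lerDl.
have : ln eta <= ln y by rewrite ler_ln ?posrE// ltW.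
by rewrite ltr0_norm// ler0_norm//; lra.
Qed.

End log_estimates.

Section law_of_weight.
Context {d0 : measure_display} {T0 : measurableType d0} {R : realType}.
Variables (P0 : probability T0 R) (W : {RV P0 >-> R}).

Let mW : measurable_fun setT (W : T0 -> R). Proof. exact: measurable_funP. Qed.

Let mWR : @measurable_fun _ _ T0 (measurableTypeR R) setT W.
Proof. by move=> mT B mB; exact: (mW mT mB). Qed.

Let WR : {mfun T0 >-> measurableTypeR R} :=
  HB.pack (W : T0 -> R) (isMeasurableFun.Build _ _ T0 (measurableTypeR R) _ mWR).

(* [distribution P0 W] lives on [R] with another measure display. *)
Definition weight_law : probability (measurableTypeR R) R := distribution P0 WR.

Local Notation La := weight_law.

Lemma weight_lawE (B : set R) : La B = distribution P0 W B.
Proof. by []. Qed.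

Hypotheses (W_ge0 : {ae P0, forall t : T0, 0 <= W t}) (W_mean : ('E_P0[W] = 1)%E).
Hypothesis W_log2plus : ('E_P0[fun t => (W t * log2plus (W t))%R] < +oo)%E.
Hypothesis W_log2 : ('E_P0[fun t => (W t * log2 (W t))%R] < 1)%E.

Let ln2 : 0 < ln 2 :> R. Proof. by rewrite ln_gt0//; lra. Qed.

Let mlnW : measurable_fun setT (fun t => ln (W t)).
Proof. exact: measurableT_comp (@measurable_ln R) mW. Qed.

Let mylnp : measurable_fun setT (fun t => W t * Num.max (ln (W t)) 0).
Proof. by apply: measurable_funM => //; exact: measurable_maxr. Qed.

Let ylnp_ge0 y : 0 <= y * Num.max (ln y) 0 :> R.
Proof.
have [y0|y0] := leP y 0; first by rewrite (ln0 y0) maxxx mulr0.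
by rewrite mulr_ge0 ?(ltW y0)// le_max lexx orbT.
Qed.

Lemma law_ge0 : {ae La, forall y : R, 0 <= y}.
Proof.
case: W_ge0 => N [mN PN WN].
exists [set y : R | y < 0]; split; last by move=> y /= /negP; rewrite -ltNge.
  by rewrite -set_itvNyo.
apply/eqP; rewrite eq_le measure_ge0 andbT.
rewrite -PN weight_lawE /distribution /pushforward; apply: le_measure; rewrite ?inE//.
  by rewrite -[_ @^-1` _]setTI; apply: mW => //; rewrite -set_itvNyo.
by move=> t /= Wt; apply: WN => /=; apply/negP; rewrite -ltNge.
Qed.

Lemma law_mean : (\int[La]_y `|y|%:E = 1)%E.
Proof.
rewrite ge0_integral_distribution//; last first.
  by apply/measurable_EFinP; exact: normr_measurable.
rewrite -W_mean expectation_def; apply: ae_eq_integral => //.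
- by apply/measurable_EFinP; exact: measurableT_comp.
- exact/measurable_EFinP.
case: W_ge0 => N [mN PN WN]; exists N; split => // t /= h; apply: WN => /= Wt.
by apply: h => _; rewrite ger0_norm.
Qed.

Let max_log2plus (y : R) : y * Num.max (ln y) 0 = ln 2 * (y * log2plus y).
Proof.
rewrite /log2plus /log2 mulrCA; congr (_ * _).
rewrite maxr_pMr ?(ltW ln2)// mulr0 mulrCA mulfV ?mulr1// gt_eqF//.
Qed.

Let int_ylnp : (\int[P0]_t (W t * Num.max (ln (W t)) 0)%:E < +oo)%E.
Proof.
under eq_integral do rewrite max_log2plus EFinM.
rewrite ge0_integralZl_EFin ?(ltW ln2)//.
- by rewrite lte_mul_pinfty// ?lee_fin ?(ltW ln2)//; move: W_log2plus; rewrite unlock.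
- move=> t _; rewrite lee_fin -(pmulr_rge0 _ ln2) -max_log2plus.
  exact: ylnp_ge0.
- apply/measurable_EFinP; apply: measurable_funM => //.
  by apply: measurable_maxr => //; exact: measurable_funM.
Qed.

Let int_abs : P0.-integrable setT (fun t => (W t * ln (W t))%:E).
Proof.
apply/integrableP; split; first by apply/measurable_EFinP; exact: measurable_funM.
apply: (@le_lt_trans _ _ (\int[P0]_t ((W t * Num.max (ln (W t)) 0)%:E + 1))%E).
  apply: ge0_le_integral => //.
  - by apply/measurableT_comp => //; apply/measurable_EFinP; exact: measurable_funM.
  - by apply: emeasurable_funD => //; exact/measurable_EFinP.
  - by move=> t _; rewrite -EFinD lee_fin norm_yln_le.
rewrite ge0_integralD//; last 2 first.
- by move=> t _; rewrite lee_fin.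
- exact/measurable_EFinP.
rewrite lte_add_pinfty// integral_cst// mul1e.
by rewrite (le_lt_trans (probability_le1 _ _))// ltry.
Qed.

Lemma law_log eta : 0 < eta -> eta <= 1 ->
  (\int[La]_y (`|y| * `|ln (Num.max y eta)|)%:E < +oo)%E.
Proof.
move=> eta0 eta1.
have mln : measurable_fun [set: measurableTypeR R] (fun y : R => ln (Num.max y eta)).
  by apply: measurableT_comp (@measurable_ln R) _; exact: measurable_maxr.
have mf : measurable_fun [set: measurableTypeR R] (fun y : R => `|y| * `|ln (Num.max y eta)|).
  apply: measurable_funM; first exact: normr_measurable.
  by apply: measurableT_comp => //; exact: mln.
rewrite ge0_integral_distribution//; last exact/measurable_EFinP.
apply: (@le_lt_trans _ _ (\int[P0]_t ((W t * Num.max (ln (W t)) 0)%:E +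
    (`|ln eta|)%:E * (`|W t|)%:E))%E).
  apply: ge0_le_integral => //.
  - by move=> t _; rewrite /= lee_fin mulr_ge0.
  - by apply/measurable_EFinP; exact: (measurableT_comp mf mWR).
  - apply: emeasurable_funD; first exact/measurable_EFinP.
    by apply: emeasurable_funM => //; apply/measurable_EFinP; exact: measurableT_comp.
  - by move=> t _; rewrite -EFinM -EFinD lee_fin norm_ylnmax_le.
have mnW : measurable_fun setT (fun t => (`|W t|)%:E).
  by apply/measurable_EFinP; exact: measurableT_comp.
rewrite ge0_integralD//; last 3 first.
- by move=> t _; rewrite lee_fin.
- exact/measurable_EFinP.
- exact: emeasurable_funM.
rewrite lte_add_pinfty// ge0_integralZl_EFin//.
have := law_mean; rewrite ge0_integral_distribution//; last first.
  by apply/measurable_EFinP; exact: normr_measurable.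
by move=> ->; rewrite mule1 ltry.
Qed.

Lemma law_drift : exists eta del : R, [/\ 0 < eta, eta <= 1, 0 < del &
  (\int[La]_y (`|y| * ln (Num.max y eta))%:E <= (ln 2 - 2 * del)%:E)%E].
Proof.
pose rho := (\int[P0]_t (W t * ln (W t))%:E)%E.
have rhoE : rho = ((ln 2)%:E * 'E_P0[fun t => (W t * log2 (W t))%R])%E.
  rewrite unlock -integralZl//; last first.
    have -> : (fun t => (W t * log2 (W t))%:E) =
        (fun t => ((ln 2)^-1)%:E * (W t * ln (W t))%:E)%E.
      by apply/funext => t; rewrite -EFinM /log2 mulrA mulrC.
    exact: integrableZl.
  apply: eq_integral => t _; rewrite -EFinM; congr (_%:E).
  by rewrite /log2 [RHS]mulrCA; congr (_ * _); rewrite mulrCA mulfV ?mulr1// gt_eqF.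
have rfin : rho \is a fin_num := integrable_fin_num measurableT int_abs.
pose g := ln 2 - fine rho.
have g0 : 0 < g.
  rewrite subr_gt0 -lte_fin fineK// rhoE -[ltRHS]mule1.
  by rewrite lte_pmul2l.
(* The gap [g] is split in two: [eta <= g / 2] pays for the floor, and [2 * del = g / 2] remains. *)
pose eta := Num.min 1 (g / 2).
have eta0 : 0 < eta by rewrite lt_min ltr01 divr_gt0.
have eta1 : eta <= 1 by rewrite ge_min lexx.
have etag : eta <= g / 2 by rewrite ge_min lexx orbT.
exists eta, (g / 4); split; rewrite ?divr_gt0//.
have mln : measurable_fun [set: measurableTypeR R] (fun y : R => ln (Num.max y eta)).
  by apply: measurableT_comp (@measurable_ln R) _; exact: measurable_maxr.
have mf : measurable_fun [set: measurableTypeR R] (fun y : R => `|y| * ln (Num.max y eta)).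
  by apply: measurable_funM => //; exact: normr_measurable.
have If : P0.-integrable setT (fun t => (`|W t| * ln (Num.max (W t) eta))%:E).
  apply/integrableP; split.
    by apply/measurable_EFinP; exact: (measurableT_comp mf mWR).
  have := law_log eta0 eta1; rewrite ge0_integral_distribution//; last first.
    apply/measurable_EFinP; apply: measurable_funM; first exact: normr_measurable.
    by apply: measurableT_comp => //; exact: mln.
  by under [in X in _ -> X]eq_integral do rewrite /= normrM normr_id.
rewrite (integral_distribution (X := WR))//; last exact/measurable_EFinP.
apply: (@le_trans _ _ (\int[P0]_t ((W t * ln (W t))%:E + eta%:E))%E).
  apply: le_integral => //.
  - by apply: integrableD => //; exact: finite_measure_integrable_cst.
  - by move=> t _; rewrite -EFinD lee_fin ylnmax_le.
rewrite integralD//; last exact: finite_measure_integrable_cst.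
rewrite integral_cst// -/rho -(fineK rfin).
apply: (@le_trans _ _ ((fine rho)%:E + eta%:E * 1)%E).
  by apply: leeD2l; apply: lee_wpmul2l; rewrite ?lee_fin ?(ltW eta0)// probability_le1.
by rewrite mule1 -EFinD lee_fin; rewrite /g in etag *; lra.
Qed.

End law_of_weight.

(** * Decay of the Fourier transform of the limit *)

Lemma limn_einf_lt (R : realType) (u : (\bar R)^nat) (c : \bar R) :
  (limn_einf u < c)%E -> forall N, exists n, (N <= n)%N /\ (u n < c)%E.
Proof.
move=> uc N; apply: contrapT => h.
suff : (c <= limn_einf u)%E by rewrite leNgt uc.
have cu n : (N <= n)%N -> (c <= u n)%E.
  by move=> Nn; rewrite leNgt; apply/negP => un; apply: h; exists n.
rewrite limn_einf_lim (cvg_lim _ (@cvg_einfs_sup R u))//.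
apply: (@le_trans _ _ (einfs u N)); last by apply: ereal_sup_ubound; exists N.
by apply: le_ereal_inf_tmp => _ [n /= Nn <-]; exact: cu.
Qed.

Section cosine_transform.
Context {R : realType}.
Variable mu : {finite_measure set (measurableTypeR R) -> \bar R}.

(** Real part of [exp (i th)] times the Fourier transform at [xi]. *)
Definition cosine_transform (xi th : R) : R :=
  \int[mu]_x cos (2 * pi * xi * x - th).

Lemma continuous_cos_affine (xi th : R) :
  continuous (fun x : R => cos (2 * pi * xi * x - th)).
Proof.
move=> x.
apply: (@continuous_comp _ _ _ (fun x : R => 2 * pi * xi * x - th) cos);
  last exact: continuous_cos.
by apply: cvgB; [exact: mulrl_continuous|exact: cvg_cst].
Qed.

Lemma measurable_cos_affine (xi th : R) :
  measurable_fun setT (fun x : R => cos (2 * pi * xi * x - th)).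
Proof. by apply: continuous_measurable_fun; exact: continuous_cos_affine. Qed.

Lemma integrable_cosine xi th :
  mu.-integrable setT (EFin \o (fun x : R => cos (2 * pi * xi * x - th))).
Proof.
apply: measurable_bounded_integrable => //.
  by rewrite ltey_eq fin_num_measure.
  exact: measurable_cos_affine.
by exists 1; split => // M M1 x _ /=; rewrite (le_trans (cos_max _))// ltW.
Qed.

End cosine_transform.

Section weak_limit.
Context {R : realType}.
Variables (w : seq bool -> R).
Variable mu : {finite_measure set (measurableTypeR R) -> \bar R}.
Local Notation A u := (cascade_weight w u).
Hypothesis A_ge0 : forall u, 0 <= A u.
Hypothesis w_mu : weak_cvg (cascade_approx w) mu.

Let total n : R := \sum_(u <- words n) A u.
Let mass : R := fine (mu setT).

Lemma cvg_total_mass : total n @[n --> \oo] --> mass.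
Proof.
have c1 : continuous (fun _ : R => 1 : R) by move=> x; exact: cvg_cst.
have b : [bounded (fun _ : R => 1 : R) x | x in [set: R]].
  by exists 1; split => // M M1 x _ /=; rewrite normr1 ltW.
have := w_mu c1 b.
rewrite integral_cst//= mul1e -(fineK (fin_num_measure mu _ measurableT)) -/mass.
under eq_cvg do rewrite (integral_cascade_approx_cst A_ge0)// mul1r.
by move/fine_cvg.
Qed.

Lemma total_mass_bounded : exists Y, forall n, total n <= Y.
Proof.
have /cvg_seq_bounded [M [Mr hM]] : cvgn total by apply/cvg_ex; exists mass; exact: cvg_total_mass.
exists (M + 1) => n; apply: (le_trans (ler_norm _)).
by apply: (hM (M + 1)) => //; rewrite ltrDl.
Qed.

Lemma cvg_cosine_transform xi th : xi != 0 ->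
  (\sum_(u <- words n) A u * wave xi th u) @[n --> \oo] --> cosine_transform mu xi th.
Proof.
move=> xi0.
have c : continuous (fun x : R => 1 + cos (2 * pi * xi * x - th)).
  by move=> x; apply: cvgD; [exact: cvg_cst|exact: continuous_cos_affine].
have b : [bounded 1 + cos (2 * pi * xi * x - th) | x in [set: R]].
  exists 2; split => // M M1 x _ /=; rewrite (le_trans (ler_normD _ _))// normr1.
  by have := cos_max (2 * pi * xi * x - th); lra.
have := w_mu c b.
under eq_cvg do rewrite (integral_cascade_approx_wave A_ge0 _ _ xi0).
have -> : (\int[mu]_x (1 + cos (2 * pi * xi * x - th))%:E =
    (mass + cosine_transform mu xi th)%:E)%E.
  under eq_integral do rewrite EFinD.
  rewrite integralD//; last 2 first.
  - exact: finite_measure_integrable_cst.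
  - exact: integrable_cosine.
  rewrite integral_cst// mul1e EFinD; congr (_ + _)%E.
    by rewrite fineK// fin_num_measure.
  by rewrite /cosine_transform /Rintegral fineK//;
    exact: (integrable_fin_num _ (integrable_cosine mu xi th)).
move/fine_cvg => h.
have -> : cosine_transform mu xi th = (mass + cosine_transform mu xi th) - mass.
  by rewrite addrAC subrr add0r.
suff -> : (fun n => \sum_(u <- words n) A u * wave xi th u) =
    (fun n => fine (\sum_(u <- words n) A u * (1 + wave xi th u))%:E - total n).
  exact: cvgB h cvg_total_mass.
apply/funext => n /=; rewrite /total -sumrB; apply: eq_bigr => u _.
by rewrite mulrDr mulr1 addrAC subrr add0r.
Qed.

(** The integrand is Lipschitz in the frequency with constant [2 * pi] only for [x] in the unit
    interval. Bounding the approximations and passing to the limit avoids a separate proof that [mu]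
    is carried there. *)
Lemma cosine_transform_lipschitz Y xi xi' th : (forall n, total n <= Y) ->
  cosine_transform mu xi th <= cosine_transform mu xi' th + 2 * pi * `|xi - xi'| * Y.
Proof.
move=> hY.
pose f x := `|cos (2 * pi * xi * x - th) - cos (2 * pi * xi' * x - th)|.
have cf : continuous f.
  move=> x; apply: (@cvg_norm _ R^o).
  by apply: cvgB; exact: continuous_cos_affine.
have b : [bounded f x | x in [set: R]].
  exists 2; split => // M M1 x _ /=; rewrite /f normr_id (le_trans (ler_normB _ _))//.
  have := cos_max (2 * pi * xi * x - th); have := cos_max (2 * pi * xi' * x - th); lra.
have pi0 := @pi_gt0 R.
have fle x : 0 <= x <= 1 -> f x <= 2 * pi * `|xi - xi'|.
  move=> /andP[x0 x1]; rewrite /f (le_trans (cos_lipschitz _ _))//.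
  have -> : 2 * pi * xi * x - th - (2 * pi * xi' * x - th) = (2 * pi) * ((xi - xi') * x).
    by move: pi pi0 => p _; ring.
  have p2 : 0 <= 2 * pi :> R by rewrite mulr_ge0// ltW.
  rewrite normrM (ger0_norm p2) ler_wpM2l// normrM ler_piMr// ger0_norm//.
have mf : measurable_fun setT f by exact: continuous_measurable_fun.
have := w_mu cf b.
have fint : mu.-integrable setT (EFin \o f).
  apply: measurable_bounded_integrable => //.
    by rewrite ltey_eq fin_num_measure.
have -> : (\int[mu]_x (f x)%:E = (\int[mu]_x f x)%R%:E)%E.
  by rewrite /Rintegral fineK//; exact: (integrable_fin_num _ fint).
move=> h.
have hle : \int[mu]_x f x <= 2 * pi * `|xi - xi'| * Y.
  rewrite -lee_fin; apply: (cvge_to_le h).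
  near=> n; apply: (le_trans (integral_cascade_approx_le A_ge0 n mf (fun x => normr_ge0 _) fle)).
  rewrite lee_fin; apply: ler_wpM2l (hY n).
  by apply: mulr_ge0 => //; apply: mulr_ge0 => //; exact: ltW.
have : `|cosine_transform mu xi th - cosine_transform mu xi' th| <= \int[mu]_x f x.
  rewrite /cosine_transform -RintegralB//; [|exact: integrable_cosine..].
  apply: le_normr_Rintegral => //.
  exact: (integrableB measurableT (integrable_cosine mu xi th) (integrable_cosine mu xi' th)).
have := ler_norm (cosine_transform mu xi th - cosine_transform mu xi' th); lra.
Unshelve. all: by end_near. Qed.

End weak_limit.

Lemma measurable_limn_einf d (T : measurableType d) (R : realType)
    (f : nat -> T -> \bar R) : (forall n, measurable_fun setT (f n)) ->
  measurable_fun setT (fun t => limn_einf (f^~ t)).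
Proof.
move=> mf; apply: (@emeasurable_fun_cvg _ _ _ _ (fun n t => einfs (f^~ t) n)).
  by move=> n; exact: measurable_fun_einfs.
move=> t _; rewrite limn_einf_lim (cvg_lim _ (@cvg_einfs_sup R (f^~ t)))//.
exact: cvg_einfs_sup.
Qed.

Lemma limn_einf_le (R : realType) (u : (\bar R)^nat) (c : \bar R) :
  (forall n, (u n <= c)%E) -> (limn_einf u <= c)%E.
Proof.
move=> uc; rewrite limn_einf_lim (cvg_lim _ (@cvg_einfs_sup R u))//.
apply: ge_ereal_sup => _ [n _ <-].
by apply: (le_trans _ (uc n)); apply: ereal_inf_lbound; exists n => //=.
Qed.

Lemma limn_einf_ge0 (R : realType) (u : (\bar R)^nat) :
  (forall n, (0 <= u n)%E) -> (0 <= limn_einf u)%E.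
Proof.
move=> u0; rewrite limn_einf_lim (cvg_lim _ (@cvg_einfs_sup R u))//.
apply: (@le_trans _ _ (einfs u 0)); last by apply: ereal_sup_ubound; exists 0%N.
by apply: le_ereal_inf_tmp => _ [n /= _ <-].
Qed.

(* Fatou's lemma in [n], then in [i]. *)
Lemma ae_frequently_small d (T : measurableType d) (R : realType)
    (P : probability T R) (Z : nat -> nat -> T -> R) :
  (forall i n, measurable_fun setT (Z i n)) -> (forall i n t, 0 <= Z i n t) ->
  (forall i n, (\int[P]_t (Z i n t)%:E <= (i.+1%:R^-1)%:E)%E) ->
  {ae P, forall t, forall e, 0 < e ->
    exists i, forall N, exists n, (N <= n)%N /\ Z i n t <= e}.
Proof.
move=> mZ Z0 EZ.
pose u i t := limn_einf (fun n => (Z i n t)%:E).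
have mu i : measurable_fun setT (u i).
  by apply: measurable_limn_einf => n; exact/measurable_EFinP.
have u0 i t : (0 <= u i t)%E by apply: limn_einf_ge0 => n; rewrite lee_fin.
have Eu i : (\int[P]_t u i t <= (i.+1%:R^-1)%:E)%E.
  apply: (le_trans (fatou P measurableT _ _)) => //.
  - by move=> n; exact/measurable_EFinP.
  - by move=> n t _; rewrite lee_fin.
  by apply: limn_einf_le => n; exact: EZ.
pose v t := limn_einf (u^~ t).
have mv : measurable_fun setT v by exact: measurable_limn_einf.
have v0 t : (0 <= v t)%E by exact: limn_einf_ge0.
have Ev : (\int[P]_t v t = 0)%E.
  apply/eqP; rewrite eq_le integral_ge0 ?andbT; last by move=> t _; exact: v0.
  apply: (le_trans (fatou P measurableT mu _)) => //.
  have h : (\int[P]_t u n t)%E @[n --> \oo] --> 0%E.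
    apply: (@squeeze_cvge _ _ _ _ (fun=> 0%E) _ (fun n => (n.+1%:R^-1 : R)%:E)).
    - apply: nearW => n; rewrite Eu andbT; apply: integral_ge0 => t _; exact: u0.
    - exact: cvg_cst.
    - by apply: cvg_EFin; [exact: nearW|exact: (@cvg_harmonic R)].
  rewrite is_cvg_limn_einfE; last by apply/cvg_ex; exists 0%E.
  by rewrite (cvg_lim _ h).
have : {ae P, forall t, setT t -> v t = 0%E}.
  apply/(ae_eq_integral_abs P measurableT mv).
  by under eq_integral do rewrite gee0_abs//.
apply: (@filterS _ _ (ae_filter_ringOfSetsType P)) => t /(_ I) vt e e0.
have : (v t < e%:E)%E by rewrite vt lte_fin.
move=> /limn_einf_lt /(_ 0%N)[i [_ ui]].
exists i => N; have [n [Nn zn]] := limn_einf_lt ui N.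
by exists n; split => //; rewrite ltW.
Qed.

Lemma sqrt_sum_squares_le (R : rcfType) (e c s : R) :
  0 < e -> `|c| <= e / 2 -> `|s| <= e / 2 -> Num.sqrt (c ^+ 2 + s ^+ 2) <= e.
Proof.
move=> e0 ce se.
rewrite (_ : e = Num.sqrt (e ^+ 2)); last by rewrite sqrtr_sqr ger0_norm// ltW.
rewrite ler_wsqrtr// -(real_normK (num_real c)) -(real_normK (num_real s)).
have hc := ler_pM (normr_ge0 c) (normr_ge0 c) ce ce.
have hs := ler_pM (normr_ge0 s) (normr_ge0 s) se se.
have := mulr_gt0 e0 e0; rewrite !expr2; lra.
Qed.

Section fourier.
Context {R : realType}.
Variable nu : {finite_measure set (measurableTypeR R) -> \bar R}.

Lemma cosine_transform0 xi :
  cosine_transform nu xi 0 = \int[nu]_x cos (2 * pi * xi * x).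
Proof. by apply: eq_Rintegral => x _; rewrite subr0. Qed.


Lemma cosine_transformDpi xi th :
  cosine_transform nu xi (th + pi) = - cosine_transform nu xi th.
Proof.
rewrite -mulN1r -(RintegralZl (-1) measurableT (integrable_cosine nu xi th)).
by apply: eq_Rintegral => x _; rewrite opprD addrA cosB cospi sinpi; lra.
Qed.

Lemma cosine_transform_pi xi :
  cosine_transform nu xi pi = - \int[nu]_x cos (2 * pi * xi * x).
Proof. by rewrite -cosine_transform0 -cosine_transformDpi add0r. Qed.

Lemma cosine_transform_pihalf xi :
  cosine_transform nu xi (pi / 2) = \int[nu]_x sin (2 * pi * xi * x).
Proof. by apply: eq_Rintegral => x _; rewrite cosBpihalf. Qed.

Lemma cosine_transform_Npihalf xi :
  cosine_transform nu xi (- (pi / 2)) = - \int[nu]_x sin (2 * pi * xi * x).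
Proof.
rewrite -cosine_transform_pihalf {2}(_ : pi / 2 = - (pi / 2) + pi); last by move: pi => p; lra.
by rewrite cosine_transformDpi opprK.
Qed.

Hypothesis decay : forall th e, th \in [:: 0; pi; pi / 2; - (pi / 2)] -> 0 < e ->
  exists M, forall xi, M <= xi -> cosine_transform nu xi th <= e.

Lemma fourier_transform_decay e : 0 < e -> exists M, forall xi, M <= `|xi| ->
  `|fourier_transform nu xi| <= e%:C%C.
Proof.
move=> e0; have e2 : 0 < e / 2 by lra.
have [|M1 h1] := decay (th := 0) _ e2; first by rewrite !inE eqxx.
have [|M2 h2] := decay (th := pi) _ e2; first by rewrite !inE eqxx orbT.
have [|M3 h3] := decay (th := pi / 2) _ e2; first by rewrite !inE eqxx !orbT.
have [|M4 h4] := decay (th := - (pi / 2)) _ e2; first by rewrite !inE eqxx !orbT.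
exists (Num.max (Num.max M1 M2) (Num.max M3 M4)) => xi.
rewrite !ge_max => /andP[/andP[/h1 {}h1 /h2 {}h2] /andP[/h3 {}h3 /h4 {}h4]].
rewrite cosine_transform0 in h1; rewrite cosine_transform_pi in h2.
rewrite cosine_transform_pihalf in h3; rewrite cosine_transform_Npihalf in h4.
(* Parity in [xi] reduces negative frequencies to positive ones. *)
have ec : \int[nu]_x cos (2 * pi * xi * x) = \int[nu]_x cos (2 * pi * `|xi| * x).
  apply: eq_Rintegral => x _.
  by have [|] := leP 0 xi => xi0; rewrite ?(ger0_norm xi0) ?(ltr0_norm xi0)// mulrN mulNr cosN.
have es : `|\int[nu]_x sin (2 * pi * xi * x)| = `|\int[nu]_x sin (2 * pi * `|xi| * x)|.
  have [xi0|xi0] := leP 0 xi; first by rewrite (ger0_norm xi0).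
  rewrite (ltr0_norm xi0) -normrN -cosine_transform_Npihalf; congr `|_|.
  by apply: eq_Rintegral => x _; rewrite opprK cosDpihalf mulrN mulNr sinN.
have hc : `|\int[nu]_x cos (2 * pi * xi * x)| <= e / 2.
  by rewrite ec ler_norml; apply/andP; split; lra.
have hs : `|\int[nu]_x sin (2 * pi * xi * x)| <= e / 2.
  by rewrite es ler_norml; apply/andP; split; lra.
rewrite /fourier_transform normc_def/= lecR sqrrN.
exact: sqrt_sum_squares_le.
Qed.

Lemma cvg_fourier_transform :
  fourier_transform nu xi @[xi --> +oo] --> 0 /\
  fourier_transform nu xi @[xi --> -oo] --> 0.
Proof.
have h (eps : R[i]) : 0 < eps ->
    exists M, forall xi, M < `|xi| -> `|fourier_transform nu xi| < eps.
  case: eps => a b; rewrite ltcE/= => /andP[/eqP -> a0].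
  have [M hM] := fourier_transform_decay (divr_gt0 a0 (ltr0n R 2)).
  exists M => xi /ltW /hM /le_lt_trans; apply.
  by rewrite ltcR ltr_pdivrMr// ltr_pMr// ltr1n.
split; apply/cvgr0Pnorm_lt => eps /h[M hM].
   near=> xi; apply: hM; apply: (@lt_le_trans _ _ xi); last exact: ler_norm.
  near: xi.
  by apply: nbhs_pinfty_gt; exact: num_real.
near=> xi; apply: hM; rewrite -normrN; apply: (@lt_le_trans _ _ (- xi));
  last exact: ler_norm.
rewrite ltrNr; near: xi.
by apply: nbhs_ninfty_lt; exact: num_real.
Unshelve. all: by end_near. Qed.

End fourier.

(** * From the frequency grid to all frequencies, almost surely *)

Lemma ae_forall_word d (T : measurableType d) (R : realType) (P : probability T R)
    (Q : seq bool -> T -> Prop) :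
  (forall u, {ae P, forall t, Q u t}) -> {ae P, forall t, forall u, Q u t}.
Proof.
move=> h.
pose S n t := if unpickle n is Some u then Q u t else True.
have /ae_foralln : forall n, almost_everywhere P (S n).
  move=> n; rewrite /S; case: (unpickle n) => [u|]; first exact: h.
  by apply: (@filterE _ _ (ae_filter_ringOfSetsType P)).
apply: (@filterS _ _ (ae_filter_ringOfSetsType P)) => t ht u.
by have := ht (pickle u); rewrite /S pickleK.
Qed.

Lemma limit_le_of_frequently (R : realType) (u : nat -> R) (l c : R) :
  u n @[n --> \oo] --> l -> (forall N, exists n, (N <= n)%N /\ u n <= c) -> l <= c.
Proof.
move=> ul uc; rewrite leNgt; apply/negP => cl.
have [N _ hN] := cvgr_gt l ul c cl.
by have [n [Nn]] := uc N; rewrite leNgt (hN n Nn).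
Qed.

Section decay.
Context {d : measure_display} {T : measurableType d} {R : realType}.
Variables (P : probability T R) (X : seq bool -> {RV P >-> R}).
Variables (La : probability (measurableTypeR R) R) (eta del : R).
Hypotheses (eta0 : 0 < eta) (eta1 : eta <= 1) (del0 : 0 < del).

(** Shifting the thresholds by [K] turns the sum of the rates into a tail of the convergent
    series. *)
Lemma clip_tails : {ae La, forall y, 0 <= y} -> (\int[La]_y `|y|%:E = 1)%E ->
  (\int[La]_y (`|y| * `|ln (Num.max y eta)|)%:E < +oo)%E ->
  exists K : nat -> nat, forall i, (0 < K i)%N /\
    forall n, \sum_(1 <= k < n.+1) kill_rate La eta del (k + K i) <= i.+1%:R^-1.
Proof.
move=> L0 L1 Llog.
have [C [N0 hC]] := kill_rate_sum eta0 eta1 del0 L0 L1 Llog.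
pose f k := kill_rate La eta del (k + N0).
have f0 k : 0 <= f k by exact: kill_rate_ge0.
have fC n : \sum_(0 <= k < n) f k <= C.
  have := hC (n + N0)%N.
  by rewrite -{1}(add0n N0) big_addn addnK.
suff h i : exists K : nat, (0 < K)%N /\
    forall n, \sum_(1 <= k < n.+1) kill_rate La eta del (k + K) <= i.+1%:R^-1.
  by have [K hK] := choice h; exists K.
have i0 : 0 < i.+1%:R^-1 :> R by rewrite invr_gt0.
have [N1 h1] := sum_tail_small f0 fC i0.
exists (N1 + N0).+1; split => // n.
have N1le : (N1 <= 1 + N1.+1)%N by lia.
have := h1 _ (n.+1 + N1.+1)%N N1le; rewrite big_addn addnK; apply: le_trans.
by apply: ler_sum => k _; rewrite /f (_ : k + N1.+1 + N0 = k + (N1 + N0).+1)%N//; lia.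
Qed.

Section path.
Hypothesis mE : forall k, clip_mean La eta del k <= ln 2 - 2 * del.
Variables (K : nat -> nat) (t : T) (th : R).
Variable nu : {finite_measure set (measurableTypeR R) -> \bar R}.
Local Notation W := (fun u => X u t).
Hypothesis W_ge0 : forall u, 0 <= cascade_weight W u.
Hypothesis W_nu : weak_cvg (cascade_approx W) nu.
Hypothesis bounded_first_killed : forall i, exists M, forall n,
  \sum_(0 <= k < n) first_killed X La eta del (K i) k.+1 t <= M.
Hypothesis bounded_chernoff : forall i q, (0 < q)%N -> exists M, forall n j,
  (j < q * 4 ^ n)%N -> chernoff_term X La eta del (K i) q th n j t <= M * 16 ^+ n.
Hypothesis bounded_large : forall i, exists M, forall n,
  \sum_(0 <= k < n) large_mean La del (k.+1 + K i) <= M.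
Hypothesis small_killed : forall e, 0 < e -> exists i, forall N, exists n,
  (N <= n)%N /\ killed_mass X La eta del (K i) n t <= e.

Lemma cosine_transform_decay e : 0 < e ->
  exists M, forall xi, M <= xi -> cosine_transform nu xi th <= e.
Proof.
move=> e0.
have [Y0 hY0] := total_mass_bounded W_ge0 W_nu.
pose Y := `|Y0|.
have hY n : \sum_(u <- words n) cascade_weight W u <= Y by rewrite (le_trans (hY0 n))// ler_norm.
have Yge0 : 0 <= Y by exact: normr_ge0.
(* The mesh [1 / q] makes the Lipschitz error at most [e / 2]; the grid contributes the other half
   as [3 * (e / 6)]. *)
pose q := (Num.truncn (4 * pi * Y / e)).+1.
have q0 : (0 < q)%N by [].
have q0r : 0 < q%:R :> R by rewrite ltr0n.
have qY : 2 * pi * q%:R^-1 * Y <= e / 2.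
  have : 4 * pi * Y / e < q%:R by exact: truncnS_gt.
  rewrite ltr_pdivrMr// => h.
  rewrite [leLHS]mulrAC ler_pdivrMr//.
  by move: h; move: (pi * Y) (mulrA 2 pi Y) (mulrA 4 pi Y) => z <- <-; lra.
have e6 : 0 < e / 6 by rewrite divr_gt0.
have [i hi] := small_killed e6.
have [M1 h1] := bounded_first_killed i.
have [M2 h2] := bounded_chernoff i q0.
have [M3 h3] := bounded_large i.
have [J hJ] := mean_wave_small eta0 eta1 del0 mE W_ge0 hY q0 e6 h1 h2 h3 hi.
exists (J.+1%:R / q%:R) => xi; rewrite ler_pdivrMr// => xiJ.
have xq0 : 0 <= xi * q%:R by apply: le_trans xiJ.
have : (J < Num.truncn (xi * q%:R))%N by rewrite truncn_gt_nat.
(* As [frequency q j] has numerator [j.+1], this [j] gives the last grid point not above [xi]. *)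
case E : (Num.truncn (xi * q%:R)) => [//|j]; rewrite ltnS => Jj.
have f0 : frequency q j != 0 :> R by rewrite mulf_neq0// ?invr_eq0 pnatr_eq0.
have := limit_le_of_frequently (cvg_cosine_transform W_ge0 W_nu (th := th) f0) (hJ j Jj).
have := cosine_transform_lipschitz W_ge0 W_nu xi (frequency q j) th hY.
have : 2 * pi * `|xi - frequency q j| * Y <= e / 2.
  apply: le_trans qY; apply: ler_wpM2r => //; apply: ler_wpM2l.
    by apply: mulr_ge0 => //; exact: pi_ge0.
  have := truncn_itv xq0; rewrite E => /andP[a b].
  have -> : xi - frequency q j = (xi * q%:R - j.+1%:R) / q%:R.
    by rewrite /frequency mulrBl mulfK// lt0r_neq0.
  have qV : 0 <= q%:R^-1 :> R by rewrite invr_ge0 ltW.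
  rewrite normrM (ger0_norm qV) ler_piMl// ger0_norm ?subr_ge0//.
  by rewrite lerBlDl -natr1 natr1 natr1 ltW.
move: (cosine_transform _ _ _) (cosine_transform _ _ _) (2 * pi * _ * Y) => *; lra.
Qed.

End path.
End decay.

Section almost_sure_decay.
Context {d : measure_display} {T : measurableType d} {R : realType}.
Variables (P : probability T R) (X : seq bool -> {RV P >-> R}).
Variables (La : probability (measurableTypeR R) R) (eta del : R).
Hypothesis X_indep : mutually_independent nonempty_words X.
Hypothesis X_law : forall u, u != [::] -> forall B : set R, measurable B ->
  P (X u @^-1` B) = La B.
Hypotheses (eta0 : 0 < eta) (eta1 : eta <= 1) (del0 : 0 < del).
Hypothesis La_ge0 : {ae La, forall y, 0 <= y}.
Hypothesis La_mean : (\int[La]_y `|y|%:E = 1)%E.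
Hypothesis La_log : (\int[La]_y (`|y| * `|ln (Num.max y eta)|)%:E < +oo)%E.
Hypothesis La_drift : (\int[La]_y (`|y| * ln (Num.max y eta))%:E <= (ln 2 - 2 * del)%:E)%E.

Lemma ae_cascade_weight_ge0 :
  {ae P, forall t, forall u, 0 <= cascade_weight (fun v => X v t) u}.
Proof.
have : {ae P, forall t, forall u, u != [::] -> 0 <= X u t}.
  apply: ae_forall_word => u; case: (boolP (u == [::])) => u0.
    by apply: (@filterE _ _ (ae_filter_ringOfSetsType P)).
  have [N [mN N0 hN]] := La_ge0.
  exists (X u @^-1` N); split.
  - by rewrite -[_ @^-1` _]setTI; exact: measurable_funP.
  - by rewrite X_law.
  - move=> t /= h; apply: hN => /= h'; apply: h => _; exact: h'.
apply: (@filterS _ _ (ae_filter_ringOfSetsType P)) => t h u.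
rewrite /cascade_weight; apply: mulr_ge0; first by rewrite invr_ge0 exprn_ge0.
rewrite big_nat; apply: prodr_ge0 => k /andP[k0 ku]; apply: h.
by rewrite -size_eq0 size_take_min -lt0n leq_min k0 (leq_trans k0).
Qed.

(** The random estimates concern the weights alone, so [nu] is quantified inside the event. It can
    then be instantiated at [mu t], whose measurability in [t] is not assumed. *)
Lemma ae_cosine_transform_decay th : {ae P, forall t,
  forall nu : {finite_measure set (measurableTypeR R) -> \bar R},
  weak_cvg (cascade_approx (fun u => X u t)) nu ->
  forall e, 0 < e -> exists M, forall xi, M <= xi -> cosine_transform nu xi th <= e}.
Proof.
have mE := clip_mean_le eta0 del0 La_mean La_log La_drift.
have [K hK] := clip_tails eta0 eta1 del0 La_ge0 La_mean La_log.
have K0 i : (0 < K i)%N by have [] := hK i.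
have tail i n : \sum_(1 <= k < n.+1) kill_rate La eta del (k + K i) <= i.+1%:R^-1.
  by have [_ ->] := hK i.
have h1 : {ae P, forall t, forall i, exists M, forall n,
    \sum_(0 <= k < n) first_killed X La eta del (K i) k.+1 t <= M}.
  apply: ae_foralln => i.
  apply: (@ae_bounded_series _ _ _ P (fun k => first_killed X La eta del (K i) k.+1) i.+1%:R^-1).
  - by move=> k; exact: measurable_first_killed.
  - by move=> k t; exact: first_killed_ge0.
  move=> n; have := sum_expect_first_killed X_indep X_law eta0 del0 (K0 i) La_mean n.
  by rewrite [X in (X <= _)%E]big_add1 => /le_trans; apply; rewrite lee_fin.
have h2 : {ae P, forall t, forall i q, exists M, forall n j,
    (j < q.+1 * 4 ^ n)%N -> chernoff_term X La eta del (K i) q.+1 th n j t <= M * 16 ^+ n}.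
  by apply: ae_foralln => i; apply: ae_foralln => q; exact: ae_chernoff_bound.
have h3 i : exists M, forall n, \sum_(0 <= k < n) large_mean La del (k.+1 + K i) <= M.
  exists i.+1%:R^-1 => n; apply: le_trans (tail i n); rewrite big_add1/=.
  apply: ler_sum => k _; rewrite /kill_rate lerDl; apply: divr_ge0; last exact: sqr_ge0.
  by apply: Rintegral_ge0 => y _; rewrite mulr_ge0// sqr_ge0.
have h4 : {ae P, forall t, forall e, 0 < e -> exists i, forall N, exists n,
    (N <= n)%N /\ killed_mass X La eta del (K i) n t <= e}.
  apply: (@ae_frequently_small _ _ _ P (fun i n => killed_mass X La eta del (K i) n)).
  - by move=> i n; exact: measurable_killed_mass.
  - by move=> i n t; exact: killed_mass_ge0.
  move=> i n; apply: (le_trans (expect_killed_mass X_indep X_law eta0 del0 (K0 i) La_mean n)).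
  by rewrite lee_fin.
have F := ae_filter_ringOfSetsType P.
apply: (@filterS3 _ _ F _ _ _ _ _ (@filterI _ _ F _ _ ae_cascade_weight_ge0 h1) h2 h4).
move=> t [A0 {}h1] {}h2 {}h4 nu W_nu e e0.
have h2' i q : (0 < q)%N -> exists M, forall n j, (j < q * 4 ^ n)%N ->
    chernoff_term X La eta del (K i) q th n j t <= M * 16 ^+ n.
  by case: q => [//|q] _; exact: h2.
exact: (cosine_transform_decay eta0 eta1 del0 mE A0 W_nu h1 h2' h3 h4 e0).
Qed.

End almost_sure_decay.

Theorem theorem1p1 (R : realType)
    (d0 : measure_display) (T0 : measurableType d0) (P0 : probability T0 R)
    (W : {RV P0 >-> R})
    (W_ge0 : {ae P0, forall t : T0, 0 <= W t})
    (W_mean : ('E_P0[W] = 1)%E)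
    (W_log2plus : ('E_P0[fun t => (W t * log2plus (W t))%R] < +oo)%E)
    (W_log2 : ('E_P0[fun t => (W t * log2 (W t))%R] < 1)%E)
    (d : measure_display) (T : measurableType d) (P : probability T R)
    (X : seq bool -> {RV P >-> R})
    (X_iid : iid_copies W nonempty_words X)
    (mu : T -> {finite_measure set (measurableTypeR R) -> \bar R})
    (mu_cascade : is_mandelbrot_cascade X mu) :
  {ae P, forall t : T, (0 < mu t `[0%R, 1%R]%classic)%E ->
    fourier_transform (mu t) xi @[xi --> +oo] --> 0 /\
    fourier_transform (mu t) xi @[xi --> -oo] --> 0}.
Proof.
have [eta [del [eta0 eta1 del0 drift]]] := law_drift W_ge0 W_mean W_log2plus W_log2.
have [X_indep X_same] := X_iid.
have X_law u : u != [::] -> forall B : set R, measurable B ->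
    P (X u @^-1` B) = weight_law W B.
  by move=> u0 B mB; rewrite weight_lawE -(X_same u u0 B mB).
have decay th := ae_cosine_transform_decay X_indep X_law eta0 eta1 del0 (law_ge0 W_ge0)
  (law_mean W_ge0 W_mean) (law_log W_ge0 W_mean W_log2plus eta0 eta1) drift th.
have F := ae_filter_ringOfSetsType P.
(* The phases are indexed by [nat] to use the countable intersection of events; indices out of range
   give phase [0]. *)
have : {ae P, forall t, forall i : nat,
    forall nu : {finite_measure set (measurableTypeR R) -> \bar R},
    weak_cvg (cascade_approx (fun u => X u t)) nu ->
    forall e, 0 < e -> exists M, forall xi, M <= xi ->
    cosine_transform nu xi (nth 0 [:: 0; pi; pi / 2; - (pi / 2)] i) <= e}.
  by apply: ae_foralln => i; exact: decay.
apply: (@filterS2 _ _ F _ _ _ _ mu_cascade) => t w_mu {}decay _.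
apply: cvg_fourier_transform => th e th_in.
by have := decay (index th [:: 0; pi; pi / 2; - (pi / 2)]) (mu t) w_mu e; rewrite nth_index.
Qed.
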